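(* Let $0\le t_0<t_1\le t_2<\infty$, and let $\mathfrak{T}^1_t(x)=T(\mathfrak{B}^x_1(t))$ be the composition of a zero-mean isotropic random field $T$ on $\mathbb{S}^2_1$ with angular power spectrum $(C_l)_{l\ge0}$ and an independent rotational Brownian motion $\mathfrak{B}^x_1$ on $\mathbb{S}^2_1$ started at $x$ at time $t_0$. Then for every $x\in\mathbb{S}^2_1$ and every $g\in SO(3)$, $$\mathbb{E}\big[\mathfrak{T}^1_{t_1}(gx)\,\mathfrak{T}^1_{t_2}(gx)\big]=\sum_{l\ge0}\frac{2l+1}{4\pi}\,C_l\,\exp\big(-\mu_l(t_2-t_1)\big).$$
   Context: $\mathbb{S}^2_1$ is the unit sphere in $\mathbb{R}^3$ with surface measure $\lambda$ ($\lambda(\mathbb{S}^2_1)=4\pi$), $\triangle_{\mathbb{S}^2_1}$ the Laplace–Beltrami operator, $\mu_l=l(l+1)$, $Y_{lm}$ ($l\ge0$, $|m|\le l$) the orthonormal complex spherical harmonics, $\triangle_{\mathbb{S}^2_1}Y_{lm}=-\mu_lY_{lm}$, $Y^*_{lm}=(-1)^mY_{l,-m}$. Random field: $T=\{T(x):x\in\mathbb{S}^2_1\}$ is a real-valued (measurable) random field with $\mathbb{E}T(x)=0$, isotropic ($T(g\,\cdot)$ and $T(\cdot)$ have the same law for all $g\in SO(3)$) and $2$-weakly isotropic: $\mathbb{E}|T(gx)|^2<\infty$ and $\mathbb{E}[T(x_1)T(x_2)]=\mathbb{E}[T(gx_1)T(gx_2)]$ for all $x,x_1,x_2\in\mathbb{S}^2_1$,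 $g\in SO(3)$. It admits the spectral representation $T(x)=\sum_{l\ge0}\sum_{|m|\le l}a_{lm}Y_{lm}(x)$, $a_{lm}=\int_{\mathbb{S}^2_1}T(x)Y^*_{lm}(x)\lambda(dx)$, convergent in $L^2(P)$ for each $x$ and in $L^2(P\otimes\lambda)$, and its angular power spectrum $(C_l)$ is defined by $\mathbb{E}[a_{l_1m_1}a^*_{l_2m_2}]=\delta_{l_1}^{l_2}\delta_{m_1}^{m_2}C_{l_1}$; $\sum_l(2l+1)C_l<\infty$. Rotational Brownian motion: $\mathfrak{B}^x(t)$, $t\ge 0$, is Brownian motion on $\mathbb{S}^2_1$ started at $x$ (the diffusion with generator $\triangle_{\mathbb{S}^2_1}$, with no factor $1/2$), and $\mathfrak{B}^x_1(t)=\mathfrak{B}^x(t-t_0)$ for $t\ge t_0$. $T$ is independent of the process, and the same process $\mathfrak{B}^{gx}_1$ is used at both times $t_1,t_2$.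
   Formalization: Independence of T from the Brownian motion is taken to mean that some sigma-algebra independent of the process makes T jointly measurable; independence of the variables T(x) alone is not enough, e.g. T(x)=1 if x is the position at time t1 and 0 otherwise. *)

(* Defs.v *)
From HB Require Import structures.
From mathcomp Require Import all_boot all_order all_algebra.
From mathcomp Require Import all_classical all_reals all_analysis.
From mathcomp Require Import measurable_realfun complex.

Set Implicit Arguments.
Unset Strict Implicit.
Unset Printing Implicit Defensive.

Import Order.TTheory GRing.Theory Num.Theory.
Import numFieldNormedType.Exports.

Local Open Scope classical_set_scope.
Local Open Scope ring_scope.
Local Open Scope complex_scope.

Section sphere_type.
Context {R : realType}.

Definition norm_sq (x : 'cV[R]_3) : R := \sum_i x i 0 ^+ 2.

Definition on_sphere (x : 'cV[R]_3) : bool := norm_sq x == 1.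

End sphere_type.

Definition sphere (R : realType) := {x : 'cV[R]_3 | on_sphere x}.

Section sphere_structure.
Context {R : realType}.

HB.instance Definition _ := Choice.on (sphere R).

Definition xcoord (x : sphere R) : R := val x 0 0.
Definition ycoord (x : sphere R) : R := val x 1 0.
Definition zcoord (x : sphere R) : R := val x 2%:R 0.

Lemma sum_sq_colE (a b c : R) :
  norm_sq (\col_(i < 3) [:: a; b; c]`_i) = a ^+ 2 + b ^+ 2 + c ^+ 2.
Proof. by rewrite /norm_sq !big_ord_recr big_ord0 /= !mxE /= add0r. Qed.

Definition spherical_col (p : R * R) : 'cV[R]_3 :=
  \col_(i < 3) [:: sin p.1 * cos p.2; sin p.1 * sin p.2; cos p.1]`_i.

Lemma spherical_colP (p : R * R) : on_sphere (spherical_col p).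
Proof.
rewrite /on_sphere sum_sq_colE !exprMn -mulrDr addrC.
by rewrite (cos2Dsin2 p.2) mulr1 cos2Dsin2.
Qed.

(* p = (theta, phi): colatitude and longitude. *)
Definition spherical_coord (p : R * R) : sphere R := Sub _ (spherical_colP p).

HB.instance Definition _ := isPointed.Build (sphere R) (spherical_coord (0, 0)).

Definition coords (x : sphere R) : R * R * R := (xcoord x, ycoord x, zcoord x).

Let sphere_events := g_sigma_algebra_preimage coords.

Let sphere_sigma : sigma_algebra setT sphere_events.
Proof. exact/sigma_algebra_preimage/sigma_algebra_measurable. Qed.

Let sphere_set0 : sphere_events set0.
Proof. by have [] := sphere_sigma. Qed.

Let sphere_setC A : sphere_events A -> sphere_events (~` A).
Proof. by move=> mA; rewrite -setTD; have [_ + _] := sphere_sigma; exact. Qed.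

Let sphere_bigcup (F : (set (sphere R))^nat) :
  (forall i, sphere_events (F i)) -> sphere_events (\bigcup_i F i).
Proof. by have [_ _] := sphere_sigma; exact. Qed.

(* The Borel sigma-algebra of the sphere, as the trace of that of R^3. *)
HB.instance Definition _ := @isMeasurable.Build (preimage_display coords)
  (sphere R) sphere_events sphere_set0 sphere_setC sphere_bigcup.

End sphere_structure.

Section surface_measure.
Context {R : realType}.
Local Notation leb := (@lebesgue_measure R).

Definition angle_domain : set (R * R) := `[0, pi] `*` `[0, pi *+ 2].

(* d lambda = sin(theta) d theta d phi, total mass 4 pi. *)
Definition surface_measure (A : set (sphere R)) : \bar R :=
  (\int[leb \x leb]_(p in angle_domain `&` spherical_coord @^-1` A)
     (sin p.1)%:E)%E.

Let measurable_angle_domain : measurable angle_domain.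
Proof. exact: measurableX. Qed.

Lemma measurable_spherical_coord :
  measurable_fun setT (@spherical_coord R).
Proof.
have mc (h : R -> R) : continuous h -> measurable_fun setT h.
  exact: continuous_measurable_fun.
have m1 (h : R -> R) : continuous h -> measurable_fun setT (fun p : R * R => h p.1).
  by move=> ch; apply: measurableT_comp => //; exact: mc.
have m2 (h : R -> R) : continuous h -> measurable_fun setT (fun p : R * R => h p.2).
  by move=> ch; apply: measurableT_comp => //; exact: mc.
have mcoords : measurable_fun setT (coords \o @spherical_coord R).
  apply/measurable_fun_pairP; split.
    apply/measurable_fun_pairP; split.
      rewrite (_ : _ \o _ = (fun p : R * R => sin p.1 * cos p.2)).
        apply: measurable_funM; first by apply: m1; exact: continuous_sin.
        by apply: m2; exact: continuous_cos.
      by apply/funext => p /=; rewrite /xcoord /= mxE.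
    rewrite (_ : _ \o _ = (fun p : R * R => sin p.1 * sin p.2)).
      apply: measurable_funM; first by apply: m1; exact: continuous_sin.
      by apply: m2; exact: continuous_sin.
    by apply/funext => p /=; rewrite /ycoord /= mxE.
  rewrite (_ : _ \o _ = (fun p : R * R => cos p.1)).
    by apply: m1; exact: continuous_cos.
  by apply/funext => p /=; rewrite /zcoord /= mxE.
move=> _ _ [A mA <-]; rewrite !setTI.
by rewrite -[X in measurable X]setTI; exact: mcoords.
Qed.

Let measurable_angles A : measurable A ->
  measurable (angle_domain `&` spherical_coord @^-1` A).
Proof.
move=> mA; apply: measurableI => //.
by rewrite -[X in measurable X]setTI; exact: measurable_spherical_coord.
Qed.

Let measurable_sin1 (D : set (R * R)) :
  measurable_fun D (fun p : R * R => (sin p.1)%:E).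
Proof.
apply: measurable_funTS; apply/measurable_EFinP.
apply: (@measurableT_comp _ _ _ _ _ _ (@sin R)) => //.
by apply: continuous_measurable_fun; exact: continuous_sin.
Qed.

Let sin1_ge0 p : angle_domain p -> (0 <= (sin p.1)%:E :> \bar R)%E.
Proof.
move=> [/= + _]; rewrite in_itv /= => ?.
by rewrite lee_fin sin_ge0_pi.
Qed.

Let surface_measure0 : surface_measure set0 = 0%E.
Proof. by rewrite /surface_measure preimage_set0 setI0 integral_set0. Qed.

Let surface_measure_ge0 A : (0 <= surface_measure A)%E.
Proof. by apply: integral_ge0 => p [/sin1_ge0]. Qed.

Let surface_measure_sigma_additive : semi_sigma_additive surface_measure.
Proof.
move=> F mF tF mUF; rewrite /surface_measure preimage_bigcup setI_bigcupr.
rewrite ge0_integral_bigcup//=.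
- apply: is_cvg_ereal_nneg_natsum_cond => n _ _.
  by apply: integral_ge0 => p [/sin1_ge0].
- by move=> n; exact: measurable_angles.
- exact: measurable_sin1.
- by move=> p [n _ [/sin1_ge0]].
- apply/trivIsetP => i j _ _ ij.
  rewrite setIACA setIid -preimage_setI.
  by move/trivIsetP : tF => -> //; rewrite preimage_set0 setI0.
Qed.

HB.instance Definition _ := isMeasure.Build _ _ _ surface_measure
  surface_measure0 surface_measure_ge0 surface_measure_sigma_additive.

Let surface_measure_fin : fin_num_fun surface_measure.
Proof.
apply: lty_fin_num_fun.
apply: (@le_lt_trans _ _ (\int[leb \x leb]_(p in angle_domain) (cst 1 p))%E).
  rewrite /= /surface_measure preimage_setT setIT.
  apply: ge0_le_integral => //; first exact: measurable_sin1.
  by move=> p _; rewrite lee_fin sin_le1.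
rewrite integral_cst // mul1e /angle_domain /= product_measure1E //=.
by rewrite !lebesgue_measure_itv /=; do 2!case: ifP => _;
  rewrite ?mul0e ?mule0 ?ltry // -!EFinD -EFinM ltry.
Qed.

HB.instance Definition _ := Measure_isFinite.Build _ _ _ surface_measure
  surface_measure_fin.

End surface_measure.

Section rotations.
Context {R : realType}.

Definition is_rotation (g : 'M[R]_3) : bool :=
  (g *m g^T == 1%:M) && (\det g == 1).

End rotations.

Definition SO3 (R : realType) := {g : 'M[R]_3 | is_rotation g}.

Section rotation_action.
Context {R : realType}.

Lemma norm_sqE (x : 'cV[R]_3) : norm_sq x = (x^T *m x) 0 0.
Proof. by rewrite mxE; apply: eq_bigr => i _; rewrite mxE expr2. Qed.

Lemma rotate_subproof (g : SO3 R) (x : sphere R) :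
  on_sphere (val g *m val x).
Proof.
rewrite /on_sphere norm_sqE trmx_mul mulmxA -(mulmxA _ _ (val g)).
have /andP[/eqP /mulmx1C -> _] := valP g.
by rewrite mulmx1 -norm_sqE; exact: (valP x).
Qed.

Definition rotate (g : SO3 R) (x : sphere R) : sphere R :=
  Sub (val g *m val x) (rotate_subproof g x).

End rotation_action.

Section laplace_beltrami.
Context {R : realType}.

(* x |-> x / |x|; the value at 0 is irrelevant. *)
Definition radial_proj (x : 'cV[R]_3) : sphere R :=
  insubd (point : sphere R) ((Num.sqrt (norm_sq x))^-1 *: x).

Definition partial (i : 'I_3) (F : 'cV[R]_3 -> R) : 'cV[R]_3 -> R :=
  fun x => 'D_(delta_mx i 0) F x.

Definition iter_partial (s : seq 'I_3) (F : 'cV[R]_3 -> R) : 'cV[R]_3 -> R :=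
  foldr partial F s.

(* A function on the sphere is C^oo iff its 0-homogeneous extension
   x |-> f (x / |x|) is C^oo on R^3 \ {0}. *)
Definition sphere_smooth (f : sphere R -> R) : Prop :=
  forall (s : seq 'I_3) (x : 'cV[R]_3), x != 0 ->
    {for x, continuous (iter_partial s (f \o radial_proj))} /\
    (forall i, derivable (iter_partial s (f \o radial_proj)) x (delta_mx i 0)).

(* The Laplace-Beltrami operator is the Euclidean Laplacian of the
   0-homogeneous extension, restricted to the sphere. *)
Definition laplace_beltrami (f : sphere R -> R) (x : sphere R) : R :=
  \sum_i partial i (partial i (f \o radial_proj)) (val x).

End laplace_beltrami.

Section spherical_harmonics.
Context {R : realType}.

(* Rodrigues' formula. *)
Definition legendre (l : nat) : {poly R} :=
  ((2 ^ l * l`!)%:R)^-1 *: (('X^2 - 1) ^+ l)^`(l).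

(* For m >= 0,
     Y_lm = sqrt ((2l+1)/(4 pi) (l-m)!/(l+m)!) P_lm(cos theta) e^(i m phi)
   with P_lm(z) = (-1)^m (1 - z^2)^(m/2) (d/dz)^m P_l(z), rewritten with
   x + i y = sin theta e^(i phi) and z = cos theta. *)
Definition sph_harm_ge0 (l m : nat) (x : sphere R) : R[i] :=
  ((-1) ^+ m *
   Num.sqrt ((l.*2.+1)%:R / (4%:R * pi) * ((l - m)`!%:R / (l + m)`!%:R)) *
   ((legendre l)^`(m)).[zcoord x])%:C
  * (xcoord x +i* ycoord x) ^+ m.

Definition sph_harm (l : nat) (m : int) (x : sphere R) : R[i] :=
  match m with
  | Posz k => sph_harm_ge0 l k x
  | Negz k => (-1) ^+ k.+1 * (sph_harm_ge0 l k.+1 x)^*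
  end.

(* The sum over |m| <= l. *)
Definition sum_orders (l : nat) (F : int -> R[i]) : R[i] :=
  \sum_(k < l.*2.+1) F (k%:Z - l%:Z).

Definition Rintegral_complex d (X : measurableType d)
    (mu : {measure set X -> \bar R}) (f : X -> R[i]) : R[i] :=
  (\int[mu]_x complex.Re (f x)) +i* (\int[mu]_x complex.Im (f x)).

End spherical_harmonics.

Section random_field.
Context {R : realType} d {Omega : measurableType d}.
Variables (P : probability Omega R) (T : sphere R -> Omega -> R).

Record isotropic_field : Prop := {
  field_measurable :
    measurable_fun [set: sphere R * Omega] (fun p => T p.1 p.2) ;
  field_second_moment :
    forall x, ('E_P[(fun w => T x w ^+ 2)%R] < +oo)%E ;
  field_centred : forall x, ('E_P[T x] = 0)%E ;
  (* Equality in law, through the finite-dimensional distributions. *)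
  field_isotropic :
    forall (g : SO3 R) (n : nat) (x : 'I_n -> sphere R) (A : 'I_n -> set R),
      (forall i, measurable (A i)) ->
      P [set w | forall i, A i (T (rotate g (x i)) w)] =
      P [set w | forall i, A i (T (x i) w)] ;
  field_weakly_isotropic :
    forall (g : SO3 R) (x1 x2 : sphere R),
      ('E_P[(fun w => T x1 w * T x2 w)%R] =
       'E_P[(fun w => T (rotate g x1) w * T (rotate g x2) w)%R])%E }.

Definition fourier_coef (l : nat) (m : int) (w : Omega) : R[i] :=
  Rintegral_complex surface_measure (fun x => (T x w)%:C * (sph_harm l m x)^*).

Definition spectral_partial_sum (L : nat) (x : sphere R) (w : Omega) : R[i] :=
  \sum_(l < L) sum_orders l (fun m => fourier_coef l m w * sph_harm l m x).

Definition spectral_error (L : nat) (x : sphere R) (w : Omega) : R :=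
  ComplexField.Normc.normc ((T x w)%:C - spectral_partial_sum L x w).

Definition spectral_representation : Prop :=
  (forall x,
    ('E_P[(fun w => spectral_error L x w ^+ 2)%R] @[L --> \oo] --> 0)%E) /\
  (\int[P \x surface_measure]_p (spectral_error L p.2 p.1 ^+ 2)%:E
     @[L --> \oo] --> 0)%E.

Definition angular_power_spectrum (C : nat -> R) : Prop :=
  forall (l1 l2 : nat) (m1 m2 : int),
    `|m1| <= l1%:Z -> `|m2| <= l2%:Z ->
    Rintegral_complex P (fun w => fourier_coef l1 m1 w * (fourier_coef l2 m2 w)^*)
    = if (l1 == l2) && (m1 == m2) then (C l1)%:C else 0.

End random_field.

Section rotational_brownian_motion.
Context {R : realType} d {Omega : measurableType d}.
Variable P : probability Omega R.

(* The sigma-algebra generated by B_t, t in I. *)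
Definition process_events (B : R -> Omega -> sphere R) (I : set R) :
    set (set Omega) :=
  <<s [set A | exists2 t, I t & exists2 V, measurable V & A = B t @^-1` V] >>.

Record martingale (F : R -> set (set Omega)) (M : R -> Omega -> R) : Prop := {
  martingale_adapted : forall t, 0 <= t ->
    forall V, measurable V -> F t (M t @^-1` V) ;
  martingale_integrable : forall t, 0 <= t ->
    P.-integrable setT (EFin \o M t) ;
  martingale_mean : forall s t, 0 <= s <= t -> forall A, F s A ->
    (\int[P]_(w in A) (M t w)%:E = \int[P]_(w in A) (M s w)%:E)%E }.

(* Brownian motion on the sphere started at x: the diffusion generated by the
   Laplace-Beltrami operator (without factor 1/2), in the sense of the
   martingale problem for smooth functions. *)
Record rotational_BM (x : sphere R) (B : R -> Omega -> sphere R) : Prop := {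
  BM_measurable : forall t, 0 <= t -> measurable_fun setT (B t) ;
  BM_start : {ae P, forall w, B 0 w = x} ;
  BM_continuous : forall w,
    {within `[0, +oo[, continuous (fun t => val (B t w))} ;
  BM_generator : forall f : sphere R -> R, sphere_smooth f ->
    martingale (fun t => process_events B `[0, t])
      (fun t w => f (B t w) - f (B 0 w)
        - \int[lebesgue_measure]_(s in `[0, t]) laplace_beltrami f (B s w)) }.

(* Independence of the random field T and the process B. The sigma-algebra G
   carrying T must make T jointly measurable: independence of B from the
   sigma-algebra generated by the variables T x alone does not control T along
   the random points B_t. E.g. if U is uniform on the sphere and
   T x = 1_(U = x), then every T x is almost surely 0, hence independent of
   any process, even one passing through U. *)
Definition independent_field_process (T : sphere R -> Omega -> R)
    (B : R -> Omega -> sphere R) : Prop :=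
  exists G : set (set Omega),
    [/\ <<s G >> `<=` measurable,
        measurable_fun [set: sphere R * g_sigma_algebraType G]
          (fun p => T p.1 p.2) &
        forall A A', <<s G >> A -> process_events B `[0, +oo[ A' ->
          P (A `&` A') = (P A * P A')%E].

End rotational_brownian_motion.

(* B x is started at x at time 0; B x (t - t0) is then started at time t0. *)
Definition coordinate_changed_field (R : realType) (Omega : Type)
    (T : sphere R -> Omega -> R) (B : sphere R -> R -> Omega -> sphere R)
    (t0 t : R) (x : sphere R) (w : Omega) : R :=
  T (B x (t - t0) w) w.

(* Main.v *)
Require Import Defs.
From HB Require Import structures.
From mathcomp Require Import all_boot all_order all_algebra.
From mathcomp Require Import all_classical all_reals all_analysis.
From mathcomp Require Import measurable_realfun complex ring lra zify.

Set Implicit Arguments.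
Unset Strict Implicit.
Unset Printing Implicit Defensive.

Import Order.TTheory GRing.Theory Num.Theory.
Import numFieldNormedType.Exports.

Local Open Scope classical_set_scope.
Local Open Scope ring_scope.
Local Open Scope complex_scope.

(** Write s = t1 - t0 and t = t2 - t0, so that 0 <= s <= t and the two values of
the composition are T(B_s) and T(B_t).  The two sources of randomness are
averaged one after the other.

T and B are independent and T is jointly measurable, so T may be averaged along
a frozen path ([freezing], [mean_composition]): the expectation is that of
Gamma(B_s, B_t), where Gamma(x, y) = E[T(x) T(y)].  The spectral representation
and the orthogonality of the coefficients a_lm give
Gamma(x, y) = sum_l C_l K_l(x, y), with K_l(x, y) = sum_m Y_lm(x) conj(Y_lm(y))
([covariance_cvg]).

The real and imaginary parts of Y_lm are eigenfunctions of the Laplace-Beltrami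
operator, with eigenvalue - mu_l = - l (l + 1) ([re_harm_eigenpoly],
[im_harm_eigenpoly]).  If f is such an eigenfunction and A is an event of the
past of s, the martingale problem says that phi(u) = E[f(B_u); A] satisfies
phi(u) + mu_l (integral of phi over [s, u]) = phi(s) for u >= s, hence
phi(t) = exp(- mu_l (t - s)) phi(s) ([harmonic_decay]).  Replacing the indicator
of A by a harmonic of B_s and summing over m gives
E[K_l(B_s, B_t)] = exp(- mu_l (t - s)) E[K_l(B_s, B_s)].

Finally K_l(x, x) = (2l + 1) / (4 pi) at every point x ([zonal_kernel_diag]).
This is the constant of the formula; it also bounds K_l off the diagonal, and
with the summability of (2l + 1) C_l it lets the series be integrated term by
term.

Two ingredients are computed by hand.  The constancy of K_l on the diagonal is a
polynomial identity in z = cos(theta): its derivative telescopes over m, thanks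
to the differentiated Legendre equation ([deriv_sq_sum]).  Smoothness and
Laplacians are obtained from a small language of formal expressions in x / |x|
and 1 / |x|, which is closed under partial derivatives ([is_derive_eval]); the
Laplacian of a harmonic then follows from the product rule for second order
operators ([lapM]). *)

(** * Legendre polynomials *)

Section legendre_facts.
Context {R : realType}.
Implicit Types (l m n : nat) (p q : {poly R}).

Definition rodrigues l : {poly R} := ('X^2 - 1) ^+ l.

Lemma deriv_natr n : (n%:R : {poly R})^`() = 0.
Proof. by rewrite -polyC_natr derivC. Qed.

Lemma deriv_sqXB1 : ('X^2 - 1 : {poly R})^`() = 2 * 'X.
Proof. by rewrite derivB derivXn (deriv_natr 1) subr0 expr1 -mulr_natl. Qed.

Lemma rodrigues_ode l :
  ('X^2 - 1) * (rodrigues l)^`() = 2 * l%:R * 'X * rodrigues l.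
Proof.
rewrite /rodrigues; case: l => [|l].
  by rewrite expr0 (deriv_natr 1) !mulr0 !mul0r.
by rewrite deriv_exp deriv_sqXB1 /= !exprS -mulr_natl; ring.
Qed.

(** Differentiating the first order equation of (X^2 - 1)^l once, then n more
times; by induction, since each derivative only shifts the coefficients. *)
Lemma rodrigues_derivn_ode l n :
  ('X^2 - 1) * (rodrigues l)^`(n.+2)
    + 2 * (n%:R + 1 - l%:R) * 'X * (rodrigues l)^`(n.+1)
    + (n%:R + 1) * (n%:R - 2 * l%:R) * (rodrigues l)^`(n) = 0.
Proof.
elim: n => [|n /(congr1 (@deriv R))].
  have /(congr1 (@deriv R)) := rodrigues_ode l.
  rewrite !derivM deriv_sqXB1 !deriv_natr derivX !derivnS !derivn0 => H.
  by move/eqP: H; rewrite -subr_eq0 => /eqP H; rewrite -[RHS]H; ring.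
rewrite !(derivD, derivM, deriv_sqXB1, derivB, derivN) !(deriv_natr, derivX).
rewrite (deriv_natr 0) (deriv_natr 1) -!derivnS => H.
rewrite -(natr1 n); move: H; set u2 := derivn n.+3 _.
by set u1 := derivn n.+2 _; set u0 := derivn n.+1 _ => H; rewrite -[RHS]H; ring.
Qed.

Lemma derivn_derivn p l m : p^`(l)^`(m) = p^`(m + l).
Proof. by rewrite /derivn iterD. Qed.

(** For m = 0 this is Legendre's equation; for larger m, the equation of the
associated functions freed of their factor (1 - z^2)^(m/2). *)
Lemma legendre_derivn_ode l m :
  (1 - 'X^2) * (legendre l : {poly R})^`(m.+2)
    = 2 * (m%:R + 1) * 'X * (legendre l)^`(m.+1)
      - (l%:R * (l%:R + 1) - m%:R * (m%:R + 1)) * (legendre l)^`(m).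
Proof.
rewrite /legendre !derivnZ !derivn_derivn -!scalerAr -scalerBr; congr (_ *: _).
have := rodrigues_derivn_ode l (m + l); rewrite -!addSn natrD => H.
rewrite -/(rodrigues l).
move: H; set u2 := derivn (_.+2 + _) _.
by set u1 := derivn (_.+1 + _) _; set u0 := derivn (_ + _) _ => H;
  apply/eqP; rewrite -subr_eq0 -oppr_eq0; apply/eqP; rewrite -[RHS]H; ring.
Qed.

(** A Leibniz rule by hand: at c, only the term where all n derivatives fall on
the power survives. *)
Lemma derivn_XsubC_exp_mul (c : R) n q :
  ((('X - c%:P) ^+ n * q)^`(n)).[c] = n`!%:R * q.[c].
Proof.
elim: n q => [|n IH] q; first by rewrite expr0 mul1r derivn0 fact0 mul1r.
rewrite derivSn derivM deriv_exp derivXsubC mul1r /=.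
rewrite (_ : _ + _ = ('X - c%:P) ^+ n * (n.+1%:R * q + ('X - c%:P) * q^`())).
  rewrite IH hornerD !hornerM hornerXsubC subrr mul0r addr0 factS natrM -polyC_natr hornerC.
  by rewrite mulrA (mulrC n`!%:R).
by rewrite -mulr_natl exprS; ring.
Qed.

Lemma legendre1 l : (legendre l : {poly R}).[1] = 1.
Proof.
rewrite /legendre hornerZ.
rewrite (_ : 'X^2 - 1 = ('X - 1%:P) * ('X + 1%:P)); last by rewrite polyC1; ring.
rewrite exprMn derivn_XsubC_exp_mul horner_exp hornerD hornerX hornerC.
rewrite (_ : 1 + 1 = 2%:R) // -natrX -natrM mulnC.
by rewrite mulVf // pnatr_eq0 muln_eq0 negb_or expn_eq0 /= -lt0n fact_gt0.
Qed.

Lemma legendre_derivn_eq0 l : (legendre l : {poly R})^`(l.+1) = 0.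
Proof.
rewrite /legendre derivnZ derivn_derivn derivn_poly0 ?scaler0 //.
rewrite (leq_trans (size_poly_exp_leq _ _)) //.
by rewrite -[1]polyC1 size_XnsubC //= addSn ltnS addnn mul2n.
Qed.

End legendre_facts.

(** * The sum of squares of the associated Legendre functions *)

Section unsold.
Context {R : realType}.
Implicit Types (l m n : nat) (p q : {poly R}).
Notation P l := (legendre l : {poly R}).

(** The square of the normalisation of Y_lm, up to the factor (2l + 1) / (4 pi). *)
Definition fact_ratio l m : R := (l - m)`!%:R / (l + m)`!%:R.

Lemma fact_ratioS l m : (m < l)%N ->
  fact_ratio l m.+1 * ((l + m.+1)%:R * (l - m)%:R) = fact_ratio l m.
Proof.
move=> ml; rewrite /fact_ratio -(subnSK ml) addnS !factS !natrM.
have n0 k : k`!%:R != 0 :> R by rewrite pnatr_eq0 -lt0n fact_gt0.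
have n1 : (l + m).+1%:R != 0 :> R by rewrite pnatr_eq0.
by field; rewrite n0 -natrD nat1r n1.
Qed.

Lemma poly_deriv0_const p : p^`() = 0 -> p = (p`_0)%:P.
Proof.
move=> /polyP dp; apply/polyP => -[|i]; rewrite coefC //=.
by have := dp i; rewrite coef_deriv coef0 => /eqP; rewrite mulrn_eq0 /= => /eqP.
Qed.

(** The boundary terms of the telescoping sum in [deriv_sq_sum]. *)
Definition cross_term l m : {poly R} :=
  (1 - 'X^2) ^+ m * (P l)^`(m) * (P l)^`(m.+1).

(** The ring identity behind [deriv_assoc_legendre_sq]: w stands for 1 - X^2 and
u0, u1, u2 for three consecutive derivatives of P.  The last factor vanishes by
the Legendre equation. *)
Lemma telescoping_ring_identity (A : comPzRingType) (w z u0 u1 u2 a b : A) m :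
  (b + 1) * (- 2 * z * w ^+ m) * u1 ^+ 2 + w ^+ m.+1 * (2 * (u2 * u1 ^+ 1))
    - (w ^+ m.+1 * u1 * u2 - (a + (b + 1)) * (a - b) * (w ^+ m * u0 * u1)) =
  w ^+ m * u1 *
    (w * u2 - (2 * (b + 1) * z * u1 - (a * (a + 1) - b * (b + 1)) * u0)).
Proof. by rewrite (exprS w) expr1; move: (w ^+ m) => wm; ring. Qed.

(** The Legendre equation at order m trades the term in X P^(m+1) produced by the
factor (1 - X^2)^(m+1) for P^(m+2) and P^(m), so that the derivative becomes a
difference of consecutive cross terms. *)
Lemma deriv_assoc_legendre_sq l m : (m < l)%N ->
  ((1 - 'X^2) ^+ m.+1 * (P l)^`(m.+1) ^+ 2)^`()
  = cross_term l m.+1 - ((l + m.+1)%:R * (l - m)%:R) * cross_term l m.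
Proof.
move=> ml.
have H := legendre_derivn_ode (R := R) l m.
have d1 : (1 - 'X^2 : {poly R})^`() = - 2 * 'X.
  by rewrite -opprB derivN deriv_sqXB1 mulNr.
rewrite derivM !deriv_exp d1 /= /cross_term -derivnS.
rewrite natrD -(natr1 m) natrB; last exact: ltnW.
move: H; set u2 := derivn m.+2 _; set u1 := derivn m.+1 _; set u0 := derivn m _.
move=> H; rewrite exprS -!(mulr_natl (_ * _)).
move/eqP: H; rewrite -subr_eq0 => /eqP H.
apply/eqP; rewrite -subr_eq0; apply/eqP.
have u1E : u1^`() = u2 by rewrite /u1 -derivnS.
rewrite u1E -natr1; move: (1 - 'X^2) H => w H.
transitivity ((w ^+ m * u1) * (w * u2 -
     (2 * (m%:R + 1) * 'X * u1 -
      (l%:R * (l%:R + 1) - m%:R * (m%:R + 1)) * u0))); last by rewrite H mulr0.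
exact: telescoping_ring_identity.
Qed.

(** The sum over |m| <= l of the squared associated Legendre functions, with the
weights that normalise Y_lm; the factor 2 accounts for the negative orders. *)
Definition sq_sum l : {poly R} :=
  (P l) ^+ 2 + 2 * \sum_(m < l)
    (fact_ratio l m.+1)%:P * ((1 - 'X^2) ^+ m.+1 * (P l)^`(m.+1) ^+ 2).

(** The weights turn the derivatives of [deriv_assoc_legendre_sq] into a sum that
telescopes to - P P', since the (l+1)-st derivative of P vanishes; this cancels
the derivative of the term m = 0. *)
Lemma deriv_sq_sum l : (sq_sum l)^`() = 0.
Proof.
rewrite derivD derivM (deriv_natr 2) mul0r add0r deriv_exp (raddf_sum (@deriv R)).
rewrite (eq_bigr (fun m : 'I_l => (fact_ratio l m.+1)%:P * cross_term l m.+1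
     - (fact_ratio l m)%:P * cross_term l m)); last first.
  move=> m _; rewrite /= derivM derivC mul0r add0r deriv_assoc_legendre_sq //.
  rewrite mulrBr; congr (_ - _); rewrite mulrA -!polyC_natr -!polyCM.
  by rewrite fact_ratioS.
have -> n : \sum_(i < n) ((fact_ratio l i.+1)%:P * cross_term l i.+1
     - (fact_ratio l i)%:P * cross_term l i)
   = (fact_ratio l n)%:P * cross_term l n - (fact_ratio l 0)%:P * cross_term l 0.
  elim: n => [|n IH]; first by rewrite big_ord0 subrr.
  by rewrite big_ord_recr /= IH addrC addrA subrK.
rewrite {1}/cross_term legendre_derivn_eq0 !mulr0 sub0r /fact_ratio subn0 addn0.
rewrite divff ?pnatr_eq0 -?lt0n ?fact_gt0 // mul1r /cross_term derivn0 expr0 -mulr_natl /=.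
by rewrite expr1; ring.
Qed.

(** A constant polynomial, evaluated at 1, where only the term m = 0 remains. *)
Lemma horner_sq_sum l (z : R) : (sq_sum l).[z] = 1.
Proof.
rewrite (poly_deriv0_const (deriv_sq_sum l)) hornerC.
have <- : (sq_sum l).[1] = (sq_sum l)`_0.
  by rewrite {1}(poly_deriv0_const (deriv_sq_sum l)) hornerC.
rewrite hornerD horner_exp legendre1 expr1n hornerM horner_sum big1 ?mulr0 ?addr0 //.
have w1 : (1 - 'X^2 : {poly R}).[1] = 0.
  by rewrite -polyC1 hornerD hornerN hornerXn hornerC expr1n subrr.
by move=> i _; rewrite !hornerM exprS hornerM w1 !(mul0r, mulr0).
Qed.

End unsold.

(** * Functions of the direction x / |x| *)

Section radial_calculus.
Context {R : realType}.
Implicit Types (x : 'cV[R]_3) (i j : 'I_3).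

Lemma is_derive_coord x i j :
  is_derive x (delta_mx j 0) (fun y : 'cV[R]_3 => y i 0) (i == j)%:R.
Proof.
have @f : {linear 'cV[R]_3 -> R}.
  by exists (fun N : 'cV[R]_3 => N i 0); do 2![eexists]; do ?[constructor];
     rewrite ?mxE// => ? *; rewrite ?mxE//; move=> ?; rewrite !mxE.
have df : differentiable f x by exact: differentiable_coord.
apply: DeriveDef; first exact: diff_derivable.
have -> : (fun y : 'cV[R]_3 => y i 0) = f by [].
by rewrite deriveE // diff_lin /f /= ?mxE ?andbT //; exact: coord_continuous.
Qed.

Lemma norm_sq_gt0 x : x != 0 -> 0 < norm_sq x.
Proof.
move=> x0; rewrite lt_neqAle sumr_ge0 ?andbT => [|i _]; last exact: sqr_ge0.
apply: contra x0 => /eqP/esym/eqP; rewrite psumr_eq0 => [/allP h|i _]; last exact: sqr_ge0.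
apply/eqP/colP => i; rewrite mxE.
by have := h i (mem_index_enum _); rewrite sqrf_eq0 => /eqP.
Qed.

Lemma norm_sq_sum3 x : norm_sq x = x 0 0 ^+ 2 + x 1 0 ^+ 2 + x 2%:R 0 ^+ 2.
Proof.
rewrite /norm_sq !big_ord_recr big_ord0 /= add0r.
by congr (x _ _ ^+ 2 + x _ _ ^+ 2 + x _ _ ^+ 2); apply/val_inj.
Qed.

Lemma is_derive_comp1 (f : R -> R) (g : 'cV[R]_3 -> R) x (v : 'cV[R]_3) (a b : R) :
  is_derive (g x) 1 f a -> differentiable g x -> is_derive x v g b ->
  is_derive x v (f \o g) (a * b).
Proof.
move=> [/derivable1_diffP df fa] dg [_ gb]; have dfg := differentiable_comp dg df.
apply: DeriveDef; first exact: diff_derivable.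
rewrite deriveE // diff_comp //= -(deriveE _ dg) gb.
by rewrite -[X in 'd _ _ X]mulr1 -[b * 1]/(b *: 1) linearZ /= -deriveE // fa mulrC.
Qed.

Lemma is_derive_sqr (g : 'cV[R]_3 -> R) x v b : is_derive x v g b ->
  is_derive x v (fun y => g y ^+ 2) (2 * g x * b).
Proof.
by move=> dg; have /is_derive_eq := is_deriveX 2 dg; apply; rewrite /= expr1.
Qed.

Lemma is_derive_norm_sq x j :
  is_derive x (delta_mx j 0) (@norm_sq R) (2 * x j 0).
Proof.
have -> : @norm_sq R = \sum_(i < 3) (fun y : 'cV[R]_3 => y i 0 ^+ 2).
  by apply/funext => y; rewrite fct_sumE.
have /is_derive_eq := is_derive_sum (fun i => is_derive_sqr (is_derive_coord x i j)).
apply; rewrite (bigD1 j) //= eqxx mulr1 big1 ?addr0 // => i /negPf ->.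
by rewrite mulr0.
Qed.

Lemma differentiable_norm_sq x : differentiable (@norm_sq R) x.
Proof.
have -> : @norm_sq R = \sum_(i < 3) (fun y : 'cV[R]_3 => y i 0) ^+ 2.
  by apply/funext => y; rewrite fct_sumE.
apply: differentiable_sum => i; apply: differentiableX; exact: differentiable_coord.
Qed.

Definition inv_radius x : R := (Num.sqrt (norm_sq x))^-1.

Lemma inv_radius_derive (s : R) : 0 < s ->
  is_derive s 1 (fun s => (Num.sqrt s)^-1) (- (2 * Num.sqrt s)^-1 * (Num.sqrt s)^-1 ^+ 2).
Proof.
move=> s0; have r0 : Num.sqrt s != 0 by rewrite gt_eqF // sqrtr_gt0.
have /is_derive_eq := is_deriveV r0 (is_derive1_sqrt s0); apply.
by rewrite /GRing.scale /= exprVn; ring.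
Qed.

Lemma is_derive_inv_radius x j : x != 0 ->
  is_derive x (delta_mx j 0) inv_radius (- (x j 0 * inv_radius x ^+ 3)).
Proof.
move=> /norm_sq_gt0 s0.
have := is_derive_comp1 (inv_radius_derive s0) (differentiable_norm_sq x)
  (is_derive_norm_sq x j).
move/is_derive_eq; apply; rewrite /inv_radius invfM.
by field; rewrite gt_eqF // sqrtr_gt0.
Qed.

Lemma differentiable_inv_radius x : x != 0 -> differentiable inv_radius x.
Proof.
move=> /norm_sq_gt0 s0; apply: (@differentiable_comp _ _ _ _ _ (fun s => (Num.sqrt s)^-1)).
  exact: differentiable_norm_sq.
by apply/derivable1_diffP; have [] := inv_radius_derive s0.
Qed.

(** Formal expressions in the components of x / |x| (constructor Dir) and in
1 / |x| (constructor Inv).  The 0-homogeneous extensions of the spherical harmonics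
are values of such expressions; as the language is closed under partial
derivatives, all their iterated partial derivatives come at once. *)
Inductive expr :=
  | Cst of R | Dir of 'I_3 | Inv | Add of expr & expr | Mul of expr & expr.

Fixpoint eval (e : expr) x : R :=
  match e with
  | Cst c => c
  | Dir i => x i 0 * inv_radius x
  | Inv => inv_radius x
  | Add a b => eval a x + eval b x
  | Mul a b => eval a x * eval b x
  end.

(** The derivative of x_i / |x| in direction j is (delta_ij - u_i u_j) / |x|, where
u = x / |x|, and that of 1 / |x| is - u_j / |x|^2. *)
Fixpoint dexpr j (e : expr) : expr :=
  match e with
  | Cst c => Cst 0
  | Dir i => Mul (Add (Cst (i == j)%:R) (Mul (Cst (-1)) (Mul (Dir i) (Dir j)))) Inv
  | Inv => Mul (Cst (-1)) (Mul (Dir j) (Mul Inv Inv))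
  | Add a b => Add (dexpr j a) (dexpr j b)
  | Mul a b => Add (Mul a (dexpr j b)) (Mul b (dexpr j a))
  end.

Lemma is_derive_eval e x j : x != 0 ->
  is_derive x (delta_mx j 0) (eval e) (eval (dexpr j e) x).
Proof.
move=> x0; elim: e => [c|i||a IHa b IHb|a IHa b IHb] /=.
- exact: is_derive_cst.
- have /is_derive_eq := is_deriveM (is_derive_coord x i j) (is_derive_inv_radius j x0).
  by apply; rewrite /GRing.scale /=; ring.
- by have /is_derive_eq := is_derive_inv_radius j x0; apply; ring.
- exact: is_deriveD.
- exact: is_deriveM.
Qed.

Lemma differentiable_eval e x : x != 0 -> differentiable (eval e) x.
Proof.
move=> x0; elim: e => [c|i||a IHa b IHb|a IHa b IHb] /=.
- exact: differentiable_cst.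
- apply: differentiableM; first exact: differentiable_coord.
  exact: differentiable_inv_radius.
- exact: differentiable_inv_radius.
- exact: differentiableD.
- exact: differentiableM.
Qed.

Lemma near_nonzero x : x != 0 -> \forall y \near x, y != 0.
Proof.
move=> x0; have := norm_sq_gt0 x0.
have c : {for x, continuous (@norm_sq R)}.
  exact: differentiable_continuous (differentiable_norm_sq x).
move=> /(cvgr_gt _ c); apply: filterS => y; apply: contraTneq => ->.
by rewrite -leNgt /norm_sq big1 // => i _; rewrite mxE expr0n.
Qed.

(** Equality off the origin suffices, because a partial derivative at x only sees
a neighbourhood of x and the origin is closed. *)
Lemma iter_partial_eval (F : 'cV[R]_3 -> R) e s :
  (forall x, x != 0 -> F x = eval e x) ->
  forall x, x != 0 -> iter_partial s F x = eval (foldr dexpr e s) x.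
Proof.
move=> Fe; elim: s => [|i s IH] //= x x0.
have /near_eq_derive : \near x, iter_partial s F x = eval (foldr dexpr e s) x.
  by near do apply: IH; exact: near_nonzero.
by rewrite /partial => ->; have [] := is_derive_eval (foldr dexpr e s) i x0.
Unshelve. all: by end_near. Qed.

Lemma eval_smooth (f : sphere R -> R) e :
  (forall x, x != 0 -> (f \o radial_proj) x = eval e x) -> sphere_smooth f.
Proof.
move=> fe s x x0; have near_eq : \near x,
    eval (foldr dexpr e s) x = iter_partial s (f \o radial_proj) x.
  by near do apply/esym/iter_partial_eval => //; exact: near_nonzero.
split.
  apply: cvg_trans (near_eq_cvg near_eq) _; rewrite (iter_partial_eval s fe x0).
  exact: differentiable_continuous (differentiable_eval _ x0).
move=> i; apply: near_eq_derivable near_eq _.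
by have [] := is_derive_eval (foldr dexpr e s) i x0.
Unshelve. all: by end_near. Qed.

End radial_calculus.

(** * The Laplacian of a function of the direction *)

Section sphere_laplacian.
Context {R : realType}.
Implicit Types (x : 'cV[R]_3) (y : sphere R) (i j k : 'I_3) (a b c e : @expr R).

Lemma inv_radius_sphere y : inv_radius (val y) = 1.
Proof. by rewrite /inv_radius (eqP (valP y)) sqrtr1 invr1. Qed.

Lemma sphere_nonzero y : val y != 0.
Proof.
apply: contraTneq (valP y) => /= y0; rewrite /on_sphere /norm_sq big1 ?(eq_sym 0) ?oner_eq0 //.
by move=> i _; rewrite (_ : sval y = 0) // mxE expr0n.
Qed.

Lemma val_radial_proj x : x != 0 -> val (radial_proj x) = inv_radius x *: x.
Proof.
move=> x0; rewrite /radial_proj /inv_radius; apply: insubdK.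
rewrite unfold_in /on_sphere /norm_sq; apply/eqP.
under eq_bigr do rewrite mxE exprMn.
rewrite -mulr_sumr exprVn sqr_sqrtr ?mulVf //; last exact/ltW/norm_sq_gt0.
by rewrite gt_eqF //; exact: norm_sq_gt0.
Qed.

(** Expressions without 1 / |x|, that is polynomials in x / |x|: they are
0-homogeneous, so they are their own extension from the sphere. *)
Fixpoint angular (e : @expr R) : bool :=
  match e with
  | Cst _ | Dir _ => true
  | Inv => false
  | Add a b | Mul a b => angular a && angular b
  end.

Lemma eval_radial_proj e x : angular e -> x != 0 ->
  eval e (val (radial_proj x)) = eval e x.
Proof.
move=> + x0; elim: e => [c|i||a IHa b IHb|a IHa b IHb] //=.
- by move=> _; rewrite inv_radius_sphere mulr1 val_radial_proj // mxE mulrC.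
- by move=> /andP[/IHa -> /IHb ->].
- by move=> /andP[/IHa -> /IHb ->].
Qed.

Definition lap e x : R := \sum_i eval (dexpr i (dexpr i e)) x.
(** The carre du champ: the product of the gradients, on formal expressions. *)
Definition carre a b x : R := \sum_i eval (dexpr i a) x * eval (dexpr i b) x.

Lemma laplace_beltrami_eval (f : sphere R -> R) e : angular e ->
  (forall y, f y = eval e (val y)) ->
  forall y, laplace_beltrami f y = lap e (val y).
Proof.
move=> ae fe y; apply: eq_bigr => i _.
apply: (iter_partial_eval (e := e) [:: i; i]); last exact: sphere_nonzero.
by move=> x x0 /=; rewrite fe eval_radial_proj.
Qed.

(** The product rule of a second order operator; together with the rules for
sums and for the coordinates, it computes every Laplacian needed below. *)
Lemma lapM a b x : lap (Mul a b) x =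
  eval a x * lap b x + eval b x * lap a x + 2 * carre a b x.
Proof.
rewrite /lap /carre !mulr_sumr -!big_split /=; apply: eq_bigr => i _ /=; ring.
Qed.

Lemma lapD a b x : lap (Add a b) x = lap a x + lap b x.
Proof. by rewrite /lap -big_split. Qed.

Lemma lapC (r : R) x : lap (Cst r) x = 0.
Proof. by rewrite /lap big1. Qed.

Lemma carreMl a b c x :
  carre (Mul a b) c x = eval a x * carre b c x + eval b x * carre a c x.
Proof. by rewrite /carre !mulr_sumr -big_split; apply: eq_bigr => i _ /=; ring. Qed.

Lemma carreDl a b c x : carre (Add a b) c x = carre a c x + carre b c x.
Proof. by rewrite /carre -big_split; apply: eq_bigr => i _ /=; ring. Qed.

Lemma carreCl (r : R) c x : carre (Cst r) c x = 0.
Proof. by rewrite /carre big1 // => i _; rewrite /= mul0r. Qed.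

Lemma carre_sym a b x : carre a b x = carre b a x.
Proof. by apply: eq_bigr => i _; rewrite mulrC. Qed.

Lemma sum_delta (F : 'I_3 -> R) i :
  \sum_j (i == j)%:R * F j = F i.
Proof.
rewrite (bigD1 i) //= eqxx mul1r big1 ?addr0 // => j /negPf.
by rewrite eq_sym => ->; rewrite mul0r.
Qed.

(** At y, the gradient of x_i / |x| is the projection of the i-th basis vector to the
tangent plane. *)
Lemma carre_dir y i k :
  carre (Dir i) (Dir k) (val y) = (i == k)%:R - val y i 0 * val y k 0.
Proof.
rewrite /carre /= inv_radius_sphere.
transitivity (\sum_j ((i == j)%:R * ((k == j)%:R - val y k 0 * val y j 0)
   - (k == j)%:R * (val y i 0 * val y j 0) + val y i 0 * val y k 0 * val y j 0 ^+ 2)).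
  by apply: eq_bigr => j _; ring.
rewrite big_split /= -mulr_sumr -/(norm_sq (val y)) (eqP (valP y)) sumrB.
by rewrite !sum_delta (eq_sym k); ring.
Qed.

(** The coordinates are harmonics of degree one, with eigenvalue - 2. *)
Lemma lap_dir y i : lap (Dir i) (val y) = - 2 * val y i 0.
Proof.
rewrite /lap /= inv_radius_sphere.
transitivity (\sum_j (val y i 0 * (val y j 0 ^+ 2 * 3%:R - 1) - 2 * ((i == j)%:R * val y j 0))).
  by apply: eq_bigr => j _; rewrite eqxx mulr1n; ring.
rewrite sumrB -!mulr_sumr sumrB -mulr_suml -/(norm_sq (val y)) (eqP (valP y)).
by rewrite sum_delta !big_ord_recr big_ord0 /=; ring.
Qed.

Lemma eval_dir y i : eval (Dir i) (val y) = val y i 0.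
Proof. by rewrite /= inv_radius_sphere mulr1. Qed.

Fixpoint horner_expr (s : seq R) : @expr R :=
  if s is r :: s then Add (Mul (horner_expr s) (Dir 2%:R)) (Cst r) else Cst 0.

Lemma angular_horner_expr s : angular (horner_expr s).
Proof. by elim: s => [|r s IH] //=; rewrite IH. Qed.

Lemma Poly_cons (r : R) s : Poly (r :: s) = Poly s * 'X + r%:P.
Proof. by rewrite /= cons_poly_def. Qed.

Lemma eval_horner_expr s y : eval (horner_expr s) (val y) = (Poly s).[zcoord y].
Proof.
elim: s => [|r s IH]; first by rewrite /= horner0.
rewrite Poly_cons !hornerE -IH /zcoord -eval_dir //=.
Qed.

Lemma carre_horner_expr s b y :
  carre (horner_expr s) b (val y) = (Poly s)^`().[zcoord y] * carre (Dir 2%:R) b (val y).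
Proof.
elim: s => [|r s IH]; first by rewrite /= carreCl deriv0 horner0 mul0r.
rewrite Poly_cons [horner_expr _]/= carreDl carreMl carreCl IH eval_horner_expr eval_dir.
rewrite derivD derivM derivX derivC !(hornerD, hornerM, hornerX, hornerC, horner0).
by rewrite /zcoord; ring.
Qed.

Lemma lap_horner_expr s y : lap (horner_expr s) (val y) =
  (1 - zcoord y ^+ 2) * (Poly s)^`(2).[zcoord y] - 2 * zcoord y * (Poly s)^`().[zcoord y].
Proof.
elim: s => [|r s IH].
  by rewrite /= lapC !linear0 !horner0; ring.
rewrite Poly_cons [horner_expr _]/= lapD lapM lapC IH lap_dir carre_horner_expr carre_dir.
rewrite eval_horner_expr eval_dir !derivnS !derivn0 eqxx.
rewrite !(derivD, derivM, derivX, derivC, deriv0).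
by rewrite !(hornerD, hornerM, hornerX, hornerC, horner0) /zcoord mulr1n; ring.
Qed.

(** The real and imaginary parts of (u_0 + i u_1)^m, where u = x / |x|. *)
Fixpoint re_pow m : @expr R :=
  if m is m.+1 then
    Add (Mul (re_pow m) (Dir 0)) (Mul (Cst (-1)) (Mul (im_pow m) (Dir 1)))
  else Cst 1
with im_pow m : @expr R :=
  if m is m.+1 then Add (Mul (re_pow m) (Dir 1)) (Mul (im_pow m) (Dir 0)) else Cst 0.

Lemma angular_pow m : angular (re_pow m) && angular (im_pow m).
Proof. by elim: m => [|m /= /andP[-> ->]]. Qed.

Lemma eval_pow m y : (xcoord y +i* ycoord y) ^+ m =
  eval (re_pow m) (val y) +i* eval (im_pow m) (val y).
Proof.
elim: m => [|m IH] //; rewrite exprSr IH /= inv_radius_sphere.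
by rewrite /xcoord /ycoord; congr (_ +i* _); ring.
Qed.

(** In complex form, with w = u_0 + i u_1: the product of the gradients of w^m and
of z is - m z w^m. *)
Lemma carre_pow_z m y :
  carre (re_pow m) (Dir 2%:R) (val y) = - m%:R * zcoord y * eval (re_pow m) (val y) /\
  carre (im_pow m) (Dir 2%:R) (val y) = - m%:R * zcoord y * eval (im_pow m) (val y).
Proof.
elim: m => [|m [IHa IHb]]; first by rewrite /= !carreCl; split; ring.
rewrite /= !(carreDl, carreMl, carreCl, carre_dir) IHa IHb /= inv_radius_sphere /zcoord -natr1.
split; ring.
Qed.

(** In complex form: the bilinear product of the gradients of w^m and of w is
- m w^(m+1). *)
Lemma carre_pow m y :
  carre (re_pow m) (Dir 0) (val y) - carre (im_pow m) (Dir 1) (val y)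
    = - m%:R * eval (re_pow m.+1) (val y) /\
  carre (re_pow m) (Dir 1) (val y) + carre (im_pow m) (Dir 0) (val y)
    = - m%:R * eval (im_pow m.+1) (val y).
Proof.
elim: m => [|m [IHa IHb]]; first by rewrite /= !carreCl; split; ring.
rewrite ![re_pow m.+1]/= ![im_pow m.+1]/= !(carreDl, carreMl, carreCl, carre_dir).
move: IHa IHb.
set g1 := carre (re_pow m) (Dir 0) _; set g2 := carre (im_pow m) (Dir 1) _.
set g3 := carre (re_pow m) (Dir 1) _; set g4 := carre (im_pow m) (Dir 0) _.
move=> H1 H2.
have -> : g1 = g2 + - m%:R * eval (re_pow m.+1) (val y) by rewrite -H1; ring.
have -> : g3 = - m%:R * eval (im_pow m.+1) (val y) - g4 by rewrite -H2; ring.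
by rewrite /= inv_radius_sphere -natr1; split; ring.
Qed.

(** By the product rule applied to w^(m+1) = w^m w; the mixed term is given by
[carre_pow]. *)
Lemma lap_pow m y :
  lap (re_pow m) (val y) = - (m%:R * (m%:R + 1)) * eval (re_pow m) (val y) /\
  lap (im_pow m) (val y) = - (m%:R * (m%:R + 1)) * eval (im_pow m) (val y).
Proof.
elim: m => [|m [IHa IHb]]; first by rewrite /= !lapC; split; ring.
rewrite ![re_pow m.+1]/= ![im_pow m.+1]/= !(lapD, lapM, lapC, carreCl, carreMl) !lap_dir IHa IHb.
have [H1 H2] := carre_pow m y; move: H1 H2.
set g1 := carre (re_pow m) (Dir 0) _; set g2 := carre (im_pow m) (Dir 1) _.
set g3 := carre (re_pow m) (Dir 1) _; set g4 := carre (im_pow m) (Dir 0) _.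
move=> H1 H2.
have -> : g1 = g2 + - m%:R * eval (re_pow m.+1) (val y) by rewrite -H1; ring.
have -> : g3 = - m%:R * eval (im_pow m.+1) (val y) - g4 by rewrite -H2; ring.
by rewrite /= inv_radius_sphere -natr1; split; ring.
Qed.

End sphere_laplacian.

(** * Spherical harmonics *)

Section harmonics.
Context {R : realType}.
Implicit Types (y : sphere R) (e : @expr R) (f : sphere R -> R).

Definition sphere_poly f := exists2 e, angular e & forall y, f y = eval e (val y).

Lemma sphere_poly_smooth f : sphere_poly f -> sphere_smooth f.
Proof.
move=> [e ae fe]; apply: (@eval_smooth _ _ e) => x x0 /=.
by rewrite fe eval_radial_proj.
Qed.

Lemma abs_coord_le1 y i : `|val y i 0| <= 1.
Proof.
rewrite -(@ler_pXn2r _ 2) ?nnegrE // expr1n real_normK ?num_real //.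
rewrite -(eqP (valP y)) /norm_sq (bigD1 i) //= lerDl sumr_ge0 // => j _.
exact: sqr_ge0.
Qed.

(** On the sphere the coordinates are bounded by 1. *)
Lemma sphere_poly_bounded f : sphere_poly f -> exists2 M, 0 <= M & forall y, `|f y| <= M.
Proof.
move=> [e ae fe]; suff [M M0 HM] : exists2 M, 0 <= M & forall y, `|eval e (val y)| <= M.
  by exists M => // y; rewrite fe.
elim: e ae {fe} => [c _|i _||a IHa b IHb /= /andP[/IHa [Ma Ma0 Ha] /IHb [Mb Mb0 Hb]]
   |a IHa b IHb /= /andP[/IHa [Ma Ma0 Ha] /IHb [Mb Mb0 Hb]]] //.
- by exists `|c|.
- by exists 1 => // y; rewrite eval_dir abs_coord_le1.
- exists (Ma + Mb) => [|y]; first exact: addr_ge0.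
  exact: (le_trans (ler_normD _ _) (lerD (Ha y) (Hb y))).
- exists (Ma * Mb) => [|y]; first exact: mulr_ge0.
  by rewrite normrM; apply: ler_pM; rewrite ?normr_ge0 ?Ha ?Hb.
Qed.

Lemma measurable_coord i : measurable_fun setT (fun y => val y i 0).
Proof.
have mc : measurable_fun setT (@coords R).
  by move=> _ B mB; rewrite setTI; apply: (ex_intro2 _ _ B) => //; rewrite setTI.
have m1 := measurableT_comp (@measurable_fst _ _ _ _) (measurableT_comp (@measurable_fst _ _ _ _) mc).
have m2 := measurableT_comp (@measurable_snd _ _ _ _) (measurableT_comp (@measurable_fst _ _ _ _) mc).
have m3 := measurableT_comp (@measurable_snd _ _ _ _) mc.
case: i => -[|[|[|//]]] p.
- rewrite (_ : (fun y => _) = @xcoord R); first exact: m1.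
  by apply/funext => y; congr (val y _ _); apply/val_inj.
- rewrite (_ : (fun y => _) = @ycoord R); first exact: m2.
  by apply/funext => y; congr (val y _ _); apply/val_inj.
- rewrite (_ : (fun y => _) = @zcoord R); first exact: m3.
  by apply/funext => y; congr (val y _ _); apply/val_inj.
Qed.

Lemma sphere_poly_measurable f : sphere_poly f -> measurable_fun setT f.
Proof.
move=> [e ae fe]; rewrite (_ : f = fun y => eval e (val y)); last exact/funext.
elim: e ae {fe} => [c _|i _||a IHa b IHb /= /andP[/IHa Ha /IHb Hb]
   |a IHa b IHb /= /andP[/IHa Ha /IHb Hb]] //.
- under eq_fun do rewrite eval_dir; exact: measurable_coord.
- exact: measurable_funD.
- exact: measurable_funM.
Qed.

Lemma sphere_poly_comp_continuous f (Y : topologicalType) (D : set Y) (u : Y -> sphere R) :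
  sphere_poly f -> {within D, continuous (fun t => val (u t))} ->
  {within D, continuous (f \o u)}.
Proof.
move=> [e ae fe] cu t.
have -> : f \o u = eval e \o (fun x => val (u x)) by apply/funext => x /=.
apply: (@continuous_comp (subspace D)); first exact: cu.
exact: differentiable_continuous (differentiable_eval e (sphere_nonzero (u t))).
Qed.

Definition laplace_eigenpoly l f :=
  sphere_poly f /\ forall y, laplace_beltrami f y = - (l * l.+1)%:R * f y.

(** For f = q(z) a with a a part of w^m, the product rule gives, up to the factor a,
(1 - z^2) q'' - 2 (m + 1) z q' - m (m + 1) q, and the differentiated Legendre
equation for q = P^(m) turns this into - l (l + 1) q. *)
Lemma laplace_eigenpoly_expr l (c : R) m a (f : sphere R -> R) :
  a = re_pow m \/ a = im_pow m ->
  (forall y, f y = c * ((legendre l)^`(m)).[zcoord y] * eval a (val y)) ->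
  laplace_eigenpoly l f.
Proof.
move=> ha fE; pose q : {poly R} := (legendre l)^`(m).
pose e := Mul (Cst c) (Mul (horner_expr q) a).
have aa : angular a by have /andP[h1 h2] := @angular_pow R m; case: ha => ->.
have ae : angular e by rewrite /e /= angular_horner_expr.
have fe y : f y = eval e (val y).
  by rewrite fE /e /= eval_horner_expr polyseqK mulrA.
split; first by exists e.
move=> y; rewrite (laplace_beltrami_eval ae fe) fE /e lapM lapC carreCl lapM.
have -> : lap a (val y) = - (m%:R * (m%:R + 1)) * eval a (val y).
  by case: ha => ->; have [] := lap_pow m y.
rewrite lap_horner_expr carre_horner_expr carre_sym.
have -> : carre a (Dir 2%:R) (val y) = - m%:R * zcoord y * eval a (val y).
  by case: ha => ->; have [] := carre_pow_z m y.
rewrite eval_horner_expr polyseqK [eval (Cst c) _]/=.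
have := congr1 (fun p : {poly R} => p.[zcoord y]) (legendre_derivn_ode (R := R) l m).
rewrite /= -!polyC1 -!polyC_natr !(hornerM, hornerD, hornerN, hornerX, hornerXn, hornerC).
rewrite -/q natrM.
move: (zcoord y) (eval a _) (eval (horner_expr q) _) (q^`()^`()).[_] q^`().[_] q.[_].
move=> z A E d2 d1 d0 H.
apply/eqP; rewrite -subr_eq0; apply/eqP; move/eqP: H; rewrite -subr_eq0 => /eqP H.
by rewrite -[RHS](mulr0 (c * A)) -[X in _ = _ * X]H -(natr1 l); ring.
Qed.

Lemma Re_mul_realC (r : R) (z : R[i]) : complex.Re (r%:C * z) = r * complex.Re z.
Proof. by case: z => a b /=; ring. Qed.

Lemma Im_mul_realC (r : R) (z : R[i]) : complex.Im (r%:C * z) = r * complex.Im z.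
Proof. by case: z => a b /=; ring. Qed.

Definition norm_factor l m : R :=
  (-1) ^+ m * Num.sqrt ((l.*2.+1)%:R / (4%:R * pi) * fact_ratio l m).

Lemma Re_sph_harm_ge0 l m y : complex.Re (sph_harm_ge0 l m y) =
  norm_factor l m * ((legendre l)^`(m)).[zcoord y] * eval (re_pow m) (val y).
Proof. by rewrite /sph_harm_ge0 Re_mul_realC eval_pow. Qed.

Lemma Im_sph_harm_ge0 l m y : complex.Im (sph_harm_ge0 l m y) =
  norm_factor l m * ((legendre l)^`(m)).[zcoord y] * eval (im_pow m) (val y).
Proof. by rewrite /sph_harm_ge0 Im_mul_realC eval_pow. Qed.

Definition re_harm l m y : R := complex.Re (sph_harm l m y).
Definition im_harm l m y : R := complex.Im (sph_harm l m y).

Lemma signC k : ((-1) ^+ k : R[i]) = ((-1) ^+ k)%:C.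
Proof. by rewrite rmorphXn rmorphN rmorph1. Qed.

Lemma Re_conj (z : R[i]) : complex.Re z^* = complex.Re z.
Proof. by case: z. Qed.

Lemma Im_conj (z : R[i]) : complex.Im z^* = - complex.Im z.
Proof. by case: z. Qed.

Lemma re_harm_eigenpoly l m : laplace_eigenpoly l (re_harm l m).
Proof.
case: m => k; rewrite /re_harm /sph_harm.
  apply: (@laplace_eigenpoly_expr l (norm_factor l k) k); first by left.
  by move=> y; rewrite Re_sph_harm_ge0.
apply: (@laplace_eigenpoly_expr l ((-1) ^+ k.+1 * norm_factor l k.+1) k.+1); first by left.
by move=> y; rewrite signC Re_mul_realC Re_conj Re_sph_harm_ge0 !mulrA.
Qed.

Lemma im_harm_eigenpoly l m : laplace_eigenpoly l (im_harm l m).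
Proof.
case: m => k; rewrite /im_harm /sph_harm.
  apply: (@laplace_eigenpoly_expr l (norm_factor l k) k); first by right.
  by move=> y; rewrite Im_sph_harm_ge0.
apply: (@laplace_eigenpoly_expr l ((-1) ^+ k * norm_factor l k.+1) k.+1); first by right.
by move=> y; rewrite signC Im_mul_realC Im_conj Im_sph_harm_ge0 exprS; ring.
Qed.

Lemma re_harm_Negz l (k : nat) y :
  re_harm l (Negz k) y = (-1) ^+ k.+1 * re_harm l k.+1 y.
Proof. by rewrite /re_harm [sph_harm l (Negz k) y]/= signC Re_mul_realC Re_conj. Qed.

Lemma im_harm_Negz l (k : nat) y :
  im_harm l (Negz k) y = - ((-1) ^+ k.+1 * im_harm l k.+1 y).
Proof.
by rewrite /im_harm [sph_harm l (Negz k) y]/= signC Im_mul_realC Im_conj mulrN.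
Qed.

(** The real part of the sum over m of Y_lm(x) conj(Y_lm(y)), which is the part that
enters the covariance of a real field. *)
Definition zonal_kernel l x y : R := \sum_(k < l.*2.+1)
  (re_harm l (k%:Z - l%:Z) x * re_harm l (k%:Z - l%:Z) y +
   im_harm l (k%:Z - l%:Z) x * im_harm l (k%:Z - l%:Z) y).

(** The orders - l, ..., l are enumerated as k - l with k < 2l + 1. *)
Lemma sum_symmetric (F : int -> R) l : (forall k : nat, F (Negz k) = F k.+1) ->
  \sum_(k < l.*2.+1) F (k%:Z - l%:Z) = F 0 + 2 * \sum_(k < l) F k.+1.
Proof.
move=> Fs; elim: l => [|l IH]; first by rewrite big_ord_recl !big_ord0 mulr0.
rewrite doubleS big_ord_recl big_ord_recr [\sum_(i < l.+1) _]big_ord_recr /=.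
have -> : \sum_(i < (l.*2).+1) F ((bump 0 (widen_ord (leqnSn (l.*2).+1) i))%:Z - l.+1%:Z)
  = \sum_(k < l.*2.+1) F (k%:Z - l%:Z).
  apply: eq_bigr => i _; congr F; rewrite /bump /= -!natz natrD -(natr1 l); ring.
rewrite IH sub0r -NegzE Fs; have -> : (bump 0 l.*2.+1)%:Z - l.+1%:Z = l.+1%:Z.
  by rewrite /bump /= -addnn -!natz !(natrD, mulrS); ring.
by ring.
Qed.

Lemma pow_norm_sq m y :
  eval (re_pow m) (val y) ^+ 2 + eval (im_pow m) (val y) ^+ 2 = (1 - zcoord y ^+ 2) ^+ m.
Proof.
have -> : 1 - zcoord y ^+ 2 = xcoord y ^+ 2 + ycoord y ^+ 2.
  by rewrite -(eqP (valP y)) norm_sq_sum3 addrK.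
elim: m => [|m IH]; first by rewrite /= expr1n expr0n addr0 expr0.
by rewrite (exprS (xcoord y ^+ 2 + _)) -IH /= inv_radius_sphere /xcoord /ycoord; ring.
Qed.

Lemma norm_factor_sq l m :
  norm_factor l m ^+ 2 = (l.*2.+1)%:R / (4%:R * pi) * fact_ratio l m.
Proof.
rewrite exprMn sqrr_sign mul1r sqr_sqrtr // mulr_ge0 ?divr_ge0 ?ler0n //.
by rewrite mulr_ge0 ?ler0n // pi_ge0.
Qed.

(** Since x^2 + y^2 = 1 - z^2 on the sphere, the sum of the |Y_lm|^2 is a polynomial
in z, namely the constant [sq_sum] up to the factor (2l + 1) / (4 pi). *)
Lemma zonal_kernel_diag l y : zonal_kernel l y y = (l.*2.+1)%:R / (4%:R * pi).
Proof.
pose F m := re_harm l m y * re_harm l m y + im_harm l m y * im_harm l m y.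
have FE (k : nat) : F k = (l.*2.+1)%:R / (4%:R * pi) * (fact_ratio l k *
    ((1 - zcoord y ^+ 2) ^+ k * ((legendre l)^`(k)).[zcoord y] ^+ 2)).
  rewrite /F /re_harm /im_harm /= Re_sph_harm_ge0 Im_sph_harm_ge0.
  by rewrite -pow_norm_sq [RHS]mulrA -norm_factor_sq; ring.
rewrite /zonal_kernel (sum_symmetric (F := F)); last first.
  move=> k; rewrite /F re_harm_Negz im_harm_Negz.
  rewrite -[RHS]mul1r -[X in _ = X * _](sqrr_sign _ k.+1).
  by move: ((-1) ^+ k.+1) (re_harm _ _ _) (im_harm _ _ _) => s r i; ring.
have := horner_sq_sum l (zcoord y).
rewrite hornerD horner_exp hornerM horner_sum -polyC_natr hornerC => H.
rewrite FE; under eq_bigr do rewrite FE.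
rewrite -mulr_sumr [2 * (_ * \sum_(_ < _) _)]mulrCA -mulrDr -[RHS]mulr1; congr (_ * _).
rewrite -[RHS]H.
congr (_ + _ * _).
  rewrite expr0 mul1r derivn0 /fact_ratio subn0 addn0 divff ?mul1r //.
apply: eq_bigr => i _; rewrite !hornerM hornerC !horner_exp hornerD hornerN hornerXn.
by rewrite -polyC1 hornerC.
Qed.

(** From |ab| <= (a^2 + b^2) / 2 for each product, the sum being then the mean of
the two diagonal values. *)
Lemma zonal_kernel_le l x y : `|zonal_kernel l x y| <= (l.*2.+1)%:R / (4%:R * pi).
Proof.
rewrite -[leRHS](@mulfK _ 2) // mulr_natr mulr2n -{1}(zonal_kernel_diag l x) -(zonal_kernel_diag l y).
rewrite /zonal_kernel -big_split /= mulr_suml.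
rewrite (le_trans (ler_norm_sum _ _ _)) // ler_sum // => k _.
set a := re_harm _ _ x; set b := re_harm _ _ y; set c := im_harm _ _ x; set d := im_harm _ _ y.
rewrite ler_norml; apply/andP; split.
  have : 0 <= (a + b) ^+ 2 + (c + d) ^+ 2 by rewrite addr_ge0 ?sqr_ge0.
  by nra.
have : 0 <= (a - b) ^+ 2 + (c - d) ^+ 2 by rewrite addr_ge0 ?sqr_ge0.
by nra.
Qed.

End harmonics.

(** * Transitivity of the rotation group *)

Section half_turn.
Context {R : realType}.
Implicit Types (x y : sphere R) (v : 'cV[R]_3).

(** The rotation by pi about the axis v. *)
Definition half_turn_mx v : 'M[R]_3 := (2 / norm_sq v) *: (v *m v^T) - 1%:M.

Lemma mul_col_tr v (x : 'cV[R]_3) : v^T *m x = (\sum_i v i 0 * x i 0)%:M.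
Proof.
apply/matrixP => i j; rewrite !ord1 !mxE eqxx mulr1n; apply: eq_bigr => k _.
by rewrite mxE.
Qed.

Lemma half_turnE v (x : 'cV[R]_3) :
  half_turn_mx v *m x = (2 / norm_sq v * (\sum_i v i 0 * x i 0)) *: v - x.
Proof.
rewrite /half_turn_mx mulmxBl mul1mx -scalemxAl -mulmxA mul_col_tr.
by rewrite mul_mx_scalar scalerA.
Qed.

Lemma det3 (A : 'M[R]_3) : \det A =
  A 0 0 * (A 1 1 * A 2%:R 2%:R - A 1 2%:R * A 2%:R 1)
  - A 0 1 * (A 1 0 * A 2%:R 2%:R - A 1 2%:R * A 2%:R 0)
  + A 0 2%:R * (A 1 0 * A 2%:R 1 - A 1 1 * A 2%:R 0).
Proof.
rewrite (expand_det_row _ ord0) !big_ord_recl big_ord0 /cofactor.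
rewrite !(expand_det_row _ ord0) !big_ord_recl !big_ord0 /cofactor !det_mx11 !mxE.
(* Indexing by naturals lets the lifted indices of the cofactors compute. *)
pose a (i j : nat) := A (inord i) (inord j).
have AE i j : A i j = a i j by rewrite /a !inord_val.
by rewrite !AE /= /bump /=; ring.
Qed.

Lemma half_turn_rotation v : v != 0 -> is_rotation (half_turn_mx v).
Proof.
move=> /norm_sq_gt0 v0; have vn : norm_sq v != 0 by rewrite gt_eqF.
apply/andP; split; apply/eqP.
  have -> : (half_turn_mx v)^T = half_turn_mx v.
    by rewrite /half_turn_mx linearB linearZ /= trmx_mul trmxK trmx1.
  have gv : half_turn_mx v *m v = v.
    rewrite half_turnE (_ : \sum_i _ = norm_sq v).
      by rewrite mulfVK // scaler_nat mulr2n addrK.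
    by apply: eq_bigr => i _; rewrite expr2.
  rewrite {2}/half_turn_mx mulmxBr mulmx1 -scalemxAr mulmxA gv /half_turn_mx.
  by rewrite opprB addrC subrK.
rewrite det3 /half_turn_mx !mxE !big_ord1 !mxE /= !mulr1n !mulr0n.
have := vn; rewrite norm_sq_sum3 => vn3.
by field.
Qed.

(** The half-turn about x + y exchanges x and y. *)
Lemma rotate_half_turn x y : val x + val y != 0 -> exists g : SO3 R, rotate g x = y.
Proof.
move=> v0.
exists (exist (fun g : 'M[R]_3 => is_rotation g) _ (half_turn_rotation v0) : SO3 R).
apply/val_inj => /=.
have nx : norm_sq (val x) = 1 by exact/eqP/(valP x).
have ny : norm_sq (val y) = 1 by exact/eqP/(valP y).
set v := val x + val y; pose s := \sum_i val x i 0 * val y i 0.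
have e1 : \sum_i v i 0 * val x i 0 = 1 + s.
  by rewrite -nx /norm_sq -big_split /=; apply: eq_bigr => i _; rewrite mxE; ring.
have e2 : norm_sq v = 2 * (1 + s).
  transitivity (norm_sq (val x) + norm_sq (val y) + 2 * s); last by rewrite nx ny; ring.
  by rewrite /norm_sq mulr_sumr -!big_split /=; apply: eq_bigr => i _; rewrite mxE; ring.
have s0 : 2 * (1 + s) != 0 by rewrite -e2 gt_eqF // norm_sq_gt0.
have c1 : 2 / (2 * (1 + s)) * (1 + s) = 1.
  by rewrite mulrAC divff.
by rewrite half_turnE e1 e2 c1 scale1r /v addrAC subrr add0r.
Qed.

(** Two points are exchanged by a half-turn unless they are antipodal, in which
case a third point serves as an intermediate. *)
Lemma rotation_invariant_cst (T : Type) (f : sphere R -> T) :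
  (forall g x, f (rotate g x) = f x) -> forall x y, f x = f y.
Proof.
move=> fg.
have half x y : val x + val y != 0 -> f x = f y.
  by move=> /rotate_half_turn[g <-]; rewrite fg.
suff fp x : f x = f (spherical_coord (0, 0)) by move=> x y; rewrite !fp.
have [xp|/half //] := eqVneq (val x + val (spherical_coord (0, 0) : sphere R)) 0.
(* x is the south pole: go through a point of the equator. *)
transitivity (f (spherical_coord (pi / 2, 0))); apply: half.
  apply: contraTneq isT => /(congr1 (fun v : 'cV[R]_3 => v 0 0)).
  have /(congr1 (fun v : 'cV[R]_3 => v 0 0)) := xp.
  rewrite !mxE /= sin0 mul0r addr0 => ->.
  by rewrite sin_pihalf cos0 mulr1 add0r => /eqP; rewrite oner_eq0.
apply: contraTneq isT => /(congr1 (fun v : 'cV[R]_3 => v 0 0)).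
by rewrite !mxE /= sin_pihalf cos0 sin0 mul0r addr0 mulr1 => /eqP; rewrite oner_eq0.
Qed.

End half_turn.

(** * Integration tools *)

Section measure_tools.
Context {R : realType}.

Lemma bounded_integrable d (X : measurableType d) (mu : {measure set X -> \bar R})
    (D : set X) (f : X -> R) (M : R) :
  measurable D -> (mu D < +oo)%E -> measurable_fun D f -> (forall x, `|f x| <= M) ->
  mu.-integrable D (EFin \o f).
Proof.
move=> mD muD mf fM; apply: measurable_bounded_integrable => //.
by exists M; split; [exact: num_real|move=> r Mr x _; exact: le_trans (fM x) (ltW Mr)].
Qed.

Lemma integrable_scale d (X : measurableType d) (mu : {measure set X -> \bar R})
    (D : set X) (f : X -> R) (c : R) : measurable D ->
  mu.-integrable D (EFin \o f) -> mu.-integrable D (EFin \o (fun x => c * f x)).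
Proof. by move=> mD fi; exact: (integrableZl mD c fi). Qed.

Lemma integrable_add d (X : measurableType d) (mu : {measure set X -> \bar R})
    (D : set X) (f g : X -> R) : measurable D ->
  mu.-integrable D (EFin \o f) -> mu.-integrable D (EFin \o g) ->
  mu.-integrable D (EFin \o (fun x => f x + g x)).
Proof. by move=> mD fi gi; exact: (integrableD mD fi gi). Qed.

Lemma integrable_sub d (X : measurableType d) (mu : {measure set X -> \bar R})
    (D : set X) (f g : X -> R) : measurable D ->
  mu.-integrable D (EFin \o f) -> mu.-integrable D (EFin \o g) ->
  mu.-integrable D (EFin \o (fun x => f x - g x)).
Proof. by move=> mD fi gi; exact: (integrableB mD fi gi). Qed.

Lemma Rintegral_sum d (X : measurableType d) (mu : {measure set X -> \bar R})
    n (F : 'I_n -> X -> R) : (forall i, mu.-integrable setT (EFin \o F i)) ->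
  mu.-integrable setT (EFin \o (fun x => \sum_i F i x)) /\
  \int[mu]_x (\sum_i F i x) = \sum_i \int[mu]_x F i x.
Proof.
elim: n F => [|n IH] F iF.
  under eq_fun do rewrite big_ord0; rewrite big_ord0; split; first exact: integrable0.
  by rewrite (@eq_Rintegral _ _ _ _ _ (cst 0)) ?Rintegral_cst ?mul0r // => x _; rewrite ?big_ord0.
under eq_fun do rewrite big_ord_recr /=; rewrite big_ord_recr /=.
rewrite (@eq_Rintegral _ _ _ _ _
  (fun x => \sum_(i < n) F (widen_ord (leqnSn n) i) x + F ord_max x)); last first.
  by move=> x _; rewrite ?big_ord_recr.
have [iS <-] := IH (fun i => F (widen_ord (leqnSn n) i)) (fun i => iF _).
by split; [exact: integrable_add|rewrite RintegralD].
Qed.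

(** Boundedness and the finite measures make K integrable on D x Y, so that the
real-valued integrals agree with the extended ones of Fubini's theorem. *)
Lemma Rintegral_fubini d1 d2 (X : measurableType d1) (Y : measurableType d2)
    (m1 : {sigma_finite_measure set X -> \bar R}) (m2 : {finite_measure set Y -> \bar R})
    (D : set X) (K : X * Y -> R) (M : R) :
  measurable D -> (m1 D < +oo)%E -> measurable_fun setT K -> (forall p, `|K p| <= M) ->
  measurable_fun setT (fun y => \int[m1]_(x in D) K (x, y)) /\
  \int[m1]_(x in D) \int[m2]_y K (x, y) = \int[m2]_y \int[m1]_(x in D) K (x, y).
Proof.
move=> mD mDoo mK KM; pose H := (EFin \o K) \_ (D `*` setT).
have m2f : (m2 setT < +oo)%E by rewrite ltey_eq fin_num_measure.
have mKx x : measurable_fun setT (fun y => K (x, y)) by exact: measurableT_comp.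
have mKy y : measurable_fun setT (fun x => K (x, y)) by exact: measurableT_comp.
have KxM x : m2.-integrable setT (fun y => (K (x, y))%:E).
  by apply: (@bounded_integrable _ _ _ _ _ M).
have KyM y : m1.-integrable D (fun x => (K (x, y))%:E).
  by apply: (@bounded_integrable _ _ _ _ _ M) => //; exact: measurable_funTS.
have mDT : measurable (D `*` [set: Y]) by exact: measurableX.
have iH : (m1 \x m2)%E.-integrable setT H.
  apply/(integrable_mkcond _ mDT); apply: (@bounded_integrable _ _ _ _ _ M) => //.
  - by rewrite /= product_measure1E // lte_mul_pinfty // ?measure_ge0 // ge0_fin_numE.
  - exact: measurable_funTS.
have HE x y : H (x, y) = ((fun x => (K (x, y))%:E) \_ D) x.
  rewrite /H !patchE; case: ifPn => [/set_mem[/= Dx _]|].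
    by rewrite (mem_set Dx).
  by move=> nD; rewrite ifN //; apply: contra nD => /set_mem Dx; apply/mem_set; split.
have innerE y : (\int[m1]_(x in D) (K (x, y))%:E = \int[m1]_x H (x, y))%E.
  by rewrite integral_mkcond; apply: eq_integral => x _; rewrite HE.
split.
  rewrite /Rintegral; under eq_fun do rewrite innerE.
  by apply: measurableT_comp => //; exact: (measurable_fubini_G iH).
rewrite /Rintegral; congr fine; transitivity (\int[m1]_x \int[m2]_y H (x, y))%E.
  rewrite integral_mkcond; apply: eq_integral => x _.
  rewrite patchE; case: ifPn => xD.
    rewrite fineK; last exact: integrable_fin_num.
    by apply: eq_integral => y _; rewrite HE patchE xD.
  by rewrite integral0_eq // => y _; rewrite HE patchE (negbTE xD).
rewrite (Fubini iH); apply: eq_integral => y _.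
rewrite fineK; last exact: integrable_fin_num.
by rewrite innerE.
Qed.

(** Caratheodory functions are jointly measurable: X is the limit of the functions
obtained by rounding u down to a multiple of 1 / (n + 1), and each of these is
measurable because it takes countably many sections.  Negative u are rounded to
0, where X takes the same value. *)
Lemma measurable_fun_continuous_section d (Y : measurableType d) (X : R -> Y -> R) :
  (forall u, measurable_fun setT (X u)) -> (forall y, continuous (X^~ y)) ->
  (forall u y, u <= 0 -> X u y = X 0 y) ->
  measurable_fun setT (fun p : R * Y => X p.1 p.2).
Proof.
move=> mX cX X0.
(* truncn rounds a negative number to 0. *)
pose grid (n : nat) (u : R) : nat := Num.truncn (u * n.+1%:R).
apply: (@measurable_fun_cvg _ _ _ setT (fun n p => X ((grid n p.1)%:R / n.+1%:R) p.2)).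
  move=> n _ V mV; rewrite setTI.
  have -> : (fun p : R * Y => X ((grid n p.1)%:R / n.+1%:R) p.2) @^-1` V =
      \bigcup_k ((grid n @^-1` [set k]) `*` (X (k%:R / n.+1%:R) @^-1` V)).
    apply/seteqP; split => [[u y] /= h|[u y] /= [k _ [/= <-]]] //.
    by exists (grid n u).
  apply: bigcup_measurable => k _; apply: measurableX; last first.
    by rewrite -[X in measurable X]setTI; exact: mX.
  have mle m : measurable [set u : R | (grid n u <= m)%N].
    rewrite (_ : [set u | _] = `]-oo, (m.+1%:R / n.+1%:R)[%classic) //.
    by apply/seteqP; split => u; rewrite /= in_itv /= truncn_le_nat ltr_pdivlMr ?ltr0n.
  have -> : grid n @^-1` [set k] =
      [set u | (grid n u <= k)%N] `\` \bigcup_(m in [set m | (m < k)%N]) [set u | (grid n u <= m)%N].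
    apply/seteqP; split => u /=.
      by move=> <-; split => // -[m /= mk]; rewrite leqNgt mk.
    move=> [uk nu]; apply/eqP; rewrite eqn_leq uk leqNgt; apply/negP => ku.
    by apply: nu; exists (grid n u) => /=.
  by apply: measurableD; [exact: mle|apply: bigcup_measurable => m _; exact: mle].
move=> [u y] _ /=.
have [u0|u0] := leP u 0.
  rewrite (_ : (fun n => _) = fun=> X u y); first exact: cvg_cst.
  apply/funext => n; rewrite (X0 u y u0).
  have -> : grid n u = 0%N; last by rewrite mul0r.
  apply/eqP; rewrite -leqn0 truncn_le_nat (@le_lt_trans _ _ 0) ?ltr01 //.
  by rewrite mulr_le0_ge0.
apply: (@continuous_cvg _ _ _ _ _ _ (X^~ y)); first exact: cX.
apply/cvgrPdist_le => e e0; near=> n.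
have n0 : 0 < n.+1%:R :> R by rewrite ltr0n.
have /andP[h1 h2] := truncn_itv (mulr_ge0 (ltW u0) (ltW n0)).
rewrite -/(grid n u) in h1 h2.
have g1 : (grid n u)%:R / n.+1%:R <= u by rewrite ler_pdivrMr.
have g2 : u <= (grid n u)%:R / n.+1%:R + n.+1%:R^-1.
  by rewrite -[X in _ + X]mul1r -mulrDl natr1 ler_pdivlMr // ltW.
rewrite ger0_norm ?subr_ge0 // lerBlDl (le_trans g2) // lerD2l ltW //.
near: n; exact: (near_infty_natSinv_lt (PosNum e0)).
Unshelve. all: by end_near. Qed.

End measure_tools.

(** * Square-integrable functions *)

Section square_integrable.
Context {R : realType} d {X : measurableType d}.
Variable m : {measure set X -> \bar R}.
Implicit Types (f g h : X -> R).

Definition sq_int f :=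
  measurable_fun setT f /\ m.-integrable setT (EFin \o (fun w => f w ^+ 2)).

Lemma abs_mul_le (a b : R) : `|a * b| <= a ^+ 2 + b ^+ 2.
Proof.
rewrite normrM -(real_normK (num_real a)) -(real_normK (num_real b)).
move: (normr_ge0 a) (normr_ge0 b); set x := `|a|; set y := `|b| => x0 y0.
rewrite (_ : x ^+ 2 + y ^+ 2 = x * y + (x * y + (x - y) ^+ 2)); last by ring.
by rewrite lerDl; apply: addr_ge0; [exact: mulr_ge0|exact: sqr_ge0].
Qed.

Lemma sq_intM f g : sq_int f -> sq_int g -> m.-integrable setT (EFin \o (fun w => f w * g w)).
Proof.
move=> [mf f2] [mg g2].
apply: (le_integrable _ _ _ (integrableD _ f2 g2)) => //.
  by apply/measurable_EFinP; exact: measurable_funM.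
move=> w _ /=; rewrite lee_fin [leRHS]ger0_norm ?addr_ge0 ?sqr_ge0 //.
exact: abs_mul_le.
Qed.

Lemma sq_intD f g : sq_int f -> sq_int g -> sq_int (fun w => f w + g w).
Proof.
move=> sf sg; have [[mf f2] [mg g2]] := (sf, sg); split; first exact: measurable_funD.
have fg := integrable_scale 2 measurableT (sq_intM sf sg).
rewrite (_ : (fun w => _) = fun w => f w ^+ 2 + g w ^+ 2 + 2 * (f w * g w)).
  by do 2 apply: integrable_add => //.
by apply/funext => w; ring.
Qed.

Lemma sq_intZ (c : R) f : sq_int f -> sq_int (fun w => c * f w).
Proof.
move=> [mf f2]; split; first exact: measurable_funM.
under eq_fun do rewrite exprMn.
exact: integrable_scale.
Qed.

Lemma sq_int0 : sq_int (fun=> 0).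
Proof.
split=> //; under eq_fun do rewrite expr0n.
exact: integrable0.
Qed.

Definition complex_sq_int (f : X -> R[i]) :=
  sq_int (fun w => complex.Re (f w)) /\ sq_int (fun w => complex.Im (f w)).
Definition complex_int (f : X -> R[i]) :=
  m.-integrable setT (EFin \o (fun w => complex.Re (f w))) /\
  m.-integrable setT (EFin \o (fun w => complex.Im (f w))).

Lemma complex_sq_intD (f g : X -> R[i]) :
  complex_sq_int f -> complex_sq_int g -> complex_sq_int (fun w => f w + g w).
Proof.
move=> [fr fi] [gr gi]; split; under eq_fun do rewrite raddfD.
  exact: sq_intD.
exact: sq_intD.
Qed.

Lemma Re_mul (a b : R[i]) : complex.Re (a * b) =
  complex.Re a * complex.Re b - complex.Im a * complex.Im b.
Proof. by case: a b => [? ?] [? ?]. Qed.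

Lemma Im_mul (a b : R[i]) : complex.Im (a * b) =
  complex.Re a * complex.Im b + complex.Im a * complex.Re b.
Proof. by case: a b => [? ?] [? ?]. Qed.

Lemma complex_sq_intZ (f : X -> R[i]) (c : R[i]) :
  complex_sq_int f -> complex_sq_int (fun w => f w * c).
Proof.
move=> [fr fi]; split.
  rewrite (_ : (fun w => _) = fun w => complex.Re c * complex.Re (f w)
     + (- complex.Im c) * complex.Im (f w)).
    by apply: sq_intD; exact: sq_intZ.
  by apply/funext => w; rewrite Re_mul; ring.
rewrite (_ : (fun w => _) = fun w => complex.Im c * complex.Re (f w)
     + complex.Re c * complex.Im (f w)).
  by apply: sq_intD; exact: sq_intZ.
by apply/funext => w; rewrite Im_mul; ring.
Qed.

Lemma complex_sq_int_sum n (f : 'I_n -> X -> R[i]) :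
  (forall i, complex_sq_int (f i)) -> complex_sq_int (fun w => \sum_i f i w).
Proof.
move=> sf; have -> : (fun w => \sum_i f i w) = \sum_i f i by apply/funext => w; rewrite fct_sumE.
elim/big_ind : _ => [|F G sF sG|i _]; [split; exact: sq_int0|exact: complex_sq_intD|exact: sf].
Qed.

Lemma complex_sq_int_conj (f : X -> R[i]) : complex_sq_int f -> complex_sq_int (fun w => (f w)^*).
Proof.
move=> [fr fi]; split.
  by rewrite (_ : (fun w => _) = fun w => complex.Re (f w)) //; apply/funext => w; case: (f w).
rewrite (_ : (fun w => _) = fun w => -1 * complex.Im (f w)); first exact: sq_intZ.
by apply/funext => w; case: (f w) => a b /=; rewrite mulN1r.
Qed.

Lemma complex_int_mul (f g : X -> R[i]) :
  complex_sq_int f -> complex_sq_int g -> complex_int (fun w => f w * g w).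
Proof.
move=> [fr fi] [gr gi]; split.
  under eq_fun do rewrite Re_mul.
  by apply: integrable_sub => //; exact: sq_intM.
under eq_fun do rewrite Im_mul.
by apply: integrable_add => //; exact: sq_intM.
Qed.

Lemma complex_intD (f g : X -> R[i]) :
  complex_int f -> complex_int g -> complex_int (fun w => f w + g w).
Proof.
move=> [fr fi] [gr gi]; split.
  by under eq_fun do rewrite raddfD; exact: integrable_add.
by under eq_fun do rewrite raddfD; exact: integrable_add.
Qed.

Lemma complex_int0 : complex_int (fun=> 0).
Proof. by split; exact: integrable0. Qed.

Local Notation CI := (Rintegral_complex m).

Lemma Rintegral_complex0 : CI (fun=> 0) = 0.
Proof. by rewrite /Rintegral_complex /= Rintegral_cst // mul0r. Qed.

Lemma Rintegral_complexD (f g : X -> R[i]) : complex_int f -> complex_int g ->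
  CI (fun w => f w + g w) = CI f + CI g.
Proof.
move=> [fr fi] [gr gi]; rewrite /Rintegral_complex.
under eq_Rintegral do rewrite raddfD.
under [X in _ +i* X]eq_Rintegral do rewrite raddfD.
by rewrite !RintegralD.
Qed.

Lemma Rintegral_complex_sum n (f : 'I_n -> X -> R[i]) : (forall i, complex_int (f i)) ->
  complex_int (fun w => \sum_i f i w) /\ CI (fun w => \sum_i f i w) = \sum_i CI (f i).
Proof.
elim: n f => [|n IH] f cf.
  under eq_fun do rewrite big_ord0; rewrite big_ord0.
  by split; [exact: complex_int0|exact: Rintegral_complex0].
under eq_fun do rewrite big_ord_recr /=; rewrite big_ord_recr /=.
have [ci ce] := IH (fun i => f (widen_ord (leqnSn n) i)) (fun i => cf _).
by rewrite Rintegral_complexD // ce; split => //; exact: complex_intD.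
Qed.

Lemma Rintegral_complexZr (f : X -> R[i]) (c : R[i]) :
  complex_int f -> CI (fun w => f w * c) = CI f * c.
Proof.
move=> [fr fi]; rewrite /Rintegral_complex.
under eq_Rintegral do rewrite Re_mul.
under [X in _ +i* X]eq_Rintegral do rewrite Im_mul.
have sc (h : X -> R) k : m.-integrable setT (EFin \o h) ->
    m.-integrable setT (EFin \o (fun w => h w * k)).
  by move=> hi; under eq_fun do rewrite mulrC; exact: integrable_scale.
rewrite RintegralB ?RintegralD ?RintegralZr //; do ?exact: sc.
by case: c.
Qed.

(** Square-integrability of the terms makes all the products integrable. *)
Lemma Rintegral_complex_bilinear n1 n2 (f : 'I_n1 -> X -> R[i]) (g : 'I_n2 -> X -> R[i]) :
  (forall i, complex_sq_int (f i)) -> (forall j, complex_sq_int (g j)) ->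
  CI (fun w => (\sum_i f i w) * (\sum_j g j w)^* ) =
  \sum_i \sum_j CI (fun w => f i w * (g j w)^* ).
Proof.
move=> sf sg.
have cfg i j : complex_int (fun w => f i w * (g j w)^* ).
  by apply: complex_int_mul => //; exact: complex_sq_int_conj.
transitivity (CI (fun w => \sum_i \sum_j f i w * (g j w)^* )).
  congr Rintegral_complex; apply/funext => w.
  by rewrite rmorph_sum mulr_suml; apply: eq_bigr => i _; rewrite mulr_sumr.
have ci i := Rintegral_complex_sum (cfg i).
rewrite (Rintegral_complex_sum (fun i => (ci i).1)).2.
by apply: eq_bigr => i _; rewrite (ci i).2.
Qed.

End square_integrable.

(** * Orthogonality to the functions of a random variable *)

Section orthogonality.
Context {R : realType}.
Local Notation leb := (@lebesgue_measure R).

Lemma layer_cake (a c : R) : 0 <= a <= c ->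
  \int[leb]_(u in `[0, c]) \1_[set u | u < a] u = a.
Proof.
move=> /andP[a0 ac]; rewrite /Rintegral.
rewrite integral_indic //; last first.
  by rewrite -[X in measurable X](_ : `]-oo, a[%classic = _) //;
    apply/seteqP; split => u; rewrite /= in_itv.
rewrite (_ : _ `&` _ = `[0, a[%classic) /=.
  rewrite lebesgue_measure_itv /= lte_fin; case: ifPn => [_|]; first by rewrite /= oppr0 addr0.
  by rewrite -leNgt => a1; apply/esym/eqP; rewrite eq_le a0 a1.
apply/seteqP; split => u /=; rewrite !in_itv /=.
  by move=> [-> /andP[-> _]].
by move=> /andP[-> ua]; rewrite ua (ltW (lt_le_trans ua ac)).
Qed.

(** If N integrates to zero over every event of V, it is orthogonal to every bounded
function of V: write g(V), shifted to be nonnegative, as the integral over u of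
the indicator of u < g(V), and exchange the integrals. *)
Lemma orthogonal_of_preimages d1 d2 (X : measurableType d1) (Y : measurableType d2)
    (m : {finite_measure set X -> \bar R}) (V : X -> Y) (N : X -> R) (M : R) :
  measurable_fun setT V -> measurable_fun setT N -> (forall w, `|N w| <= M) ->
  (forall U, measurable U -> \int[m]_(w in V @^-1` U) N w = 0) ->
  forall (g : Y -> R) (G : R), measurable_fun setT g -> (forall y, `|g y| <= G) ->
  \int[m]_w (g (V w) * N w) = 0.
Proof.
move=> mV mN NM N0 g G mg gG.
have mf : (m setT < +oo)%E by rewrite ltey_eq fin_num_measure.
have lebfin : (leb `[0%R, (G *+ 2)%R] < +oo)%E.
  by rewrite lebesgue_measure_itv /=; case: ifP => _; rewrite ?ltry // -EFinB ltry.
pose h w := g (V w) + G.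
have mh : measurable_fun setT h.
  by apply: measurable_funD => //; exact: measurableT_comp.
have h0 w : 0 <= h w <= G *+ 2.
  have := gG (V w); rewrite ler_norml => /andP[h1 h2].
  by rewrite /h mulr2n lerD2r h2 -lerBlDr sub0r h1.
pose E := [set p : R * X | p.1 < h p.2].
have mE : measurable E.
  have mhp : measurable_fun setT (fun p : R * X => h p.2 - p.1).
    by apply: measurable_funB => //; exact: measurableT_comp.
  rewrite (_ : E = (fun p : R * X => h p.2 - p.1) @^-1` `]0, +oo[).
    by rewrite -[X in measurable X]setTI; exact: mhp.
  by apply/seteqP; split => p; rewrite /E /= in_itv /= andbT subr_gt0.
have mEI : measurable_fun setT (fun p => \1_E p : R) by exact: measurable_indic.
have iN (D : set X) : measurable D -> m.-integrable D (EFin \o N).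
  move=> mD; apply: (@bounded_integrable _ _ _ _ _ _ M) => //.
    by rewrite (le_lt_trans _ mf) // le_measure ?inE.
  exact: measurable_funTS.
have igN : m.-integrable setT (fun w => (g (V w) * N w)%:E).
  apply: (@bounded_integrable _ _ _ _ _ _ (G * M)) => //.
    by apply: measurable_funM => //; exact: measurableT_comp.
  by move=> w; rewrite normrM ler_pM.
have mK : measurable_fun setT (fun p => N p.2 * \1_E p).
  by apply: measurable_funM => //; exact: measurableT_comp.
have KM p : `|N p.2 * \1_E p| <= M.
  rewrite normrM (le_trans _ (NM p.2)) // ler_piMr //.
  by rewrite indicE; case: (_ \in _); rewrite ?normr1 ?normr0.
have [_ /=] := Rintegral_fubini (m1 := leb) m (measurable_itv `[0, G *+ 2]) lebfin mK KM.
have -> : \int[leb]_(u in `[0, G *+ 2]) \int[m]_w (N w * \1_E (u, w)) = 0.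
  rewrite (_ : (fun u => _) = cst 0) ?Rintegral_cst ?mul0r //; apply/funext => u /=.
  rewrite -[RHS](N0 (g @^-1` `]u - G, +oo[)); last first.
    by rewrite -[X in measurable X]setTI; exact: mg.
  rewrite [RHS]Rintegral_mkcond; apply: eq_Rintegral => w _.
  rewrite patch_indic /=; congr (_ * _); rewrite !indicE; congr ((nat_of_bool _)%:R).
  by apply/idP/idP => /set_mem /=; rewrite ?in_itv /= ?andbT => hw; apply/mem_set;
    rewrite /E /h /= ?in_itv /= ?andbT ?ltrBlDr // -ltrBlDr.
have -> : \int[m]_w \int[leb]_(u in `[0, G *+ 2]) (N w * \1_E (u, w)) =
    \int[m]_w (g (V w) * N w + G * N w).
  apply: eq_Rintegral => w _; rewrite RintegralZl //; last first.
    apply: (@bounded_integrable _ _ _ _ _ _ 1) => //.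
    - apply: measurable_funTS; apply: (measurableT_comp mEI).
      exact: pair2_measurable.
    - by move=> p; rewrite indicE; case: (_ \in _); rewrite ?normr1 ?normr0.
  transitivity (N w * h w); last by rewrite -mulrDl mulrC.
  congr (_ * _); rewrite -[RHS](layer_cake (h0 w)).
  apply: eq_Rintegral => u _; rewrite !indicE; congr ((nat_of_bool _)%:R).
have iGN : m.-integrable setT (fun w => (G * N w)%:E).
  by under eq_fun do rewrite EFinM; apply: integrableZl => //; exact: iN.
rewrite RintegralD //.
rewrite RintegralZl //; last exact: iN.
have -> : \int[m]_w N w = 0 by rewrite -[RHS](N0 setT).
by rewrite mulr0 addr0.
Qed.

End orthogonality.

(** * From an integral equation to an exponential *)

Section exponential_solution.
Context {R : realType}.
Local Notation leb := (@lebesgue_measure R).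

(** On [s, t] the equation says phi = c - mu G with G a primitive of phi, so the
derivative of exp(mu u) (c - mu G(u)) vanishes. *)
Lemma exponential_of_integral_equation (phi : R -> R) (mu s t : R) :
  0 <= s <= t -> continuous phi ->
  (forall u, s <= u <= t ->
    phi u + mu * \int[leb]_(v in `[0, u]) phi v =
    phi s + mu * \int[leb]_(v in `[0, s]) phi v) ->
  phi t = expR (- (mu * (t - s))) * phi s.
Proof.
move=> /andP[s0 st] cphi H.
pose c := phi s + mu * \int[leb]_(v in `[0, s]) phi v.
pose G u := \int[leb]_(v in `[0, u]) phi v.
have iphi (u : R) : leb.-integrable `[0, u] (EFin \o phi).
  apply: continuous_compact_integrable; first exact: segment_compact.
  exact/continuous_subspaceT.
pose h u := expR (mu * u) * (c - mu * G u).
have hE (u : R) : s <= u <= t -> h u = expR (mu * u) * phi u.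
  by rewrite /h => /H; rewrite -/c -/(G u) => <-; rewrite addrK.
have dG (u : R) : 0 < u -> is_derive u 1 G (phi u).
  move=> u0; have [] := @continuous_FTC1_closed _ phi 0 u (u + 1) _ _ u0 (cphi u).
  - by rewrite ltrDl.
  - exact: iphi.
  - move=> d1 d2; apply: DeriveDef; [exact: d1|by rewrite -derive1E; exact: d2].
have dh (u : R) : 0 < u -> phi u = c - mu * G u -> is_derive u 1 h 0.
  move=> u0 phiu; have := dG u u0 => dGu.
  have de : is_derive u 1 (fun u => expR (mu * u)) (mu * expR (mu * u)).
    have /is_derive_eq :=
      is_derive1_comp (is_derive_expR (mu * u)) (is_deriveZ mu (is_derive_id u 1)).
    by apply; rewrite /GRing.scale /= mulr1 mulrC.
  have dc : is_derive u 1 (fun u => c - mu * G u) (- (mu * phi u)).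
    have /is_derive_eq := is_deriveB (is_derive_cst c u 1) (is_deriveZ mu dGu).
    by apply; rewrite sub0r.
  have /is_derive_eq := is_deriveM de dc; apply.
  by rewrite /GRing.scale /= phiu; ring.
have [->|lt_st] := eqVneq s t; first by rewrite subrr mulr0 oppr0 expR0 mul1r.
have {}lt_st : s < t by rewrite lt_neqAle lt_st.
have cG : {within `[s, t], continuous G}.
  have := @parameterized_integral_continuous R 0 t phi (le_trans s0 st) (iphi t).
  by apply: continuous_subspaceW => u /=; rewrite !in_itv /= => /andP[/(le_trans s0) ->].
have ch : {within `[s, t], continuous h}.
  move=> u; apply: cvgM.
    apply: (continuous_subspaceT (f := fun u => expR (mu * u))) => {}u.
    apply: continuous_comp; last exact: continuous_expR.
    by apply: mulrl_continuous.
  by apply: cvgB; [exact: cvg_cst|apply: cvgMr; exact: cG].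
have phiG (u : R) : s <= u <= t -> phi u = c - mu * G u.
  by move=> /H; rewrite -/c -/(G u) => <-; rewrite addrK.
have [u|x _] := @MVT _ h (cst 0) s t lt_st _ ch.
  rewrite in_itv /= => /andP[su ut]; apply: dh; first exact: le_lt_trans su.
  by rewrite phiG // !ltW.
rewrite mul0r => /eqP; rewrite subr_eq0 !hE ?lexx ?st // => /eqP hst.
have e0 : expR (mu * t) != 0 by rewrite gt_eqF // expR_gt0.
apply: (mulfI e0); rewrite hst mulrA -expRD; congr (expR _ * _); ring.
Qed.

End exponential_solution.

(** * Harmonics along the Brownian path *)

Section brownian_decay.
Context {R : realType} d {Omega : measurableType d}.
Local Notation leb := (@lebesgue_measure R).
Variables (P : probability Omega R) (x0 : sphere R) (B : R -> Omega -> sphere R).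
Hypothesis BM : rotational_BM P x0 B.

Lemma process_events_measurable I : (forall t, I t -> 0 <= t) ->
  process_events B I `<=` measurable.
Proof.
move=> I0; apply: smallest_sub; first exact: sigma_algebra_measurable.
move=> _ [t /I0 t0 [V mV ->]]; rewrite -[X in measurable X]setTI.
exact: (BM_measurable BM t0).
Qed.

(** The path is frozen at negative times, so that it is continuous on the whole
line. *)
Definition bm_path (f : sphere R -> R) (u : R) (w : Omega) : R := f (B (Num.max 0 u) w).

Lemma max0_ge0 (u : R) : 0 <= Num.max 0 u.
Proof. by rewrite le_max lexx. Qed.

Lemma measurable_path f u : sphere_poly f -> measurable_fun setT (bm_path f u).
Proof.
move=> pf; apply: (measurableT_comp (sphere_poly_measurable pf)).
exact: (BM_measurable BM (max0_ge0 u)).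
Qed.

Lemma continuous_path f w : sphere_poly f -> continuous (fun u => bm_path f u w).
Proof.
move=> pf u; have /subspace_continuousP cf :=
  sphere_poly_comp_continuous pf (@BM_continuous _ _ _ _ _ _ BM w).
have m0 : `[0, +oo[%classic (Num.max 0 u) by rewrite /= in_itv /= andbT max0_ge0.
apply: cvg_comp (cf _ m0) => A; rewrite /within /= !nbhs_simpl /= => nA.
have cm : {for u, continuous (fun v : R => Num.max 0 v)}.
  by apply: continuous_max; [exact: cst_continuous|exact: cvg_id].
have := cm _ nA; rewrite /= !nbhs_simpl /=; apply: filterS => v /=; apply.
by rewrite in_itv /= andbT max0_ge0.
Qed.

Lemma path_ge0 f u w : 0 <= u -> bm_path f u w = f (B u w).
Proof. by move=> u0; rewrite /bm_path max_r. Qed.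

Lemma measurable_path2 f : sphere_poly f ->
  measurable_fun setT (fun p : R * Omega => bm_path f p.1 p.2).
Proof.
move=> pf; apply: measurable_fun_continuous_section.
- by move=> u; exact: measurable_path.
- by move=> w; exact: continuous_path.
- by move=> u w u0; rewrite /bm_path maxxx max_l.
Qed.

Lemma itv0_finite (t : R) : (leb `[0%R, t] < +oo)%E.
Proof. by rewrite lebesgue_measure_itv /=; case: ifP => _; rewrite ?ltry // -EFinB ltry. Qed.

Lemma integrable_path f u A : sphere_poly f -> measurable A ->
  P.-integrable A (fun w => (bm_path f u w)%:E).
Proof.
move=> pf mA; have [M M0 fM] := sphere_poly_bounded pf.
apply: (@bounded_integrable _ _ _ _ _ _ M) => //; last by move=> w; exact: fM.
  by rewrite (le_lt_trans (probability_le1 _ mA)) // ltry.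
by apply: measurable_funTS; exact: measurable_path.
Qed.

Lemma continuous_mean_path f A : sphere_poly f -> measurable A ->
  continuous (fun u => \int[P]_(w in A) bm_path f u w).
Proof.
move=> pf mA u; have [M M0 fM] := sphere_poly_bounded pf.
have := @continuity_under_integral R _ _ P (bm_path f) A mA (u - 1) (u + 1) _ _ (cst M) _ _ u.
apply.
- by move=> v _; exact: integrable_path.
- by apply: aeW => w _ v _; exact: continuous_path.
- apply: (@bounded_integrable _ _ _ _ _ _ M) => //; last by move=> w; rewrite ger0_norm.
  by rewrite (le_lt_trans (probability_le1 _ mA)) // ltry.
- by move=> v _; apply: aeW => w _; exact: fM.
- by rewrite inE /= in_itv /= ltrBlDr ltrDl ltr01.
Qed.

(** Exchanging the mean and the time integral requires the joint measurability of
[measurable_path2]. *)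
Lemma mean_time_integral f A t : sphere_poly f -> measurable A ->
  P.-integrable A (EFin \o fun w => \int[leb]_(u in `[0, t]) bm_path f u w) /\
  \int[P]_(w in A) \int[leb]_(u in `[0, t]) bm_path f u w =
  \int[leb]_(u in `[0, t]) \int[P]_(w in A) bm_path f u w.
Proof.
move=> pf mA; have [M M0 fM] := sphere_poly_bounded pf.
have mp := measurable_path2 pf; have fin := itv0_finite t.
have PA : (P A < +oo)%E by rewrite (le_lt_trans (probability_le1 _ mA)) // ltry.
have ip w : leb.-integrable `[0, t] (EFin \o bm_path f ^~ w).
  apply: continuous_compact_integrable; first exact: segment_compact.
  by apply: continuous_subspaceT => u; exact: continuous_path.
split.
  have [mI _] := Rintegral_fubini (m1 := leb) P (measurable_itv `[0, t]) fin mp (fun p => fM _).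
  apply: (@bounded_integrable _ _ _ _ _ _ (M * fine (leb `[0%R, t]))) => //.
    exact: measurable_funTS.
  move=> w; apply: (le_trans (le_normr_Rintegral _ (ip w))) => //.
  rewrite -Rintegral_cst //; apply: le_Rintegral => //.
  - by have := integrable_norm (ip w).
  - by apply: (@bounded_integrable _ _ _ _ _ _ M) => // u; rewrite ger0_norm.
  - by move=> u _; exact: fM.
have mK : measurable_fun setT (fun p : R * Omega => bm_path f p.1 p.2 * \1_A p.2).
  by apply: measurable_funM => //; exact: measurableT_comp.
have KM p : `|bm_path f p.1 p.2 * \1_A p.2| <= M.
  rewrite normrM (le_trans _ (fM (B (Num.max 0 p.1) p.2))) // ler_piMr //.
  by rewrite indicE; case: (_ \in _); rewrite ?normr1 ?normr0.
have [_ /= swap] := Rintegral_fubini (m1 := leb) P (measurable_itv `[0, t]) fin mK KM.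
rewrite Rintegral_mkcond patch_indic.
transitivity (\int[P]_w \int[leb]_(u in `[0, t]) (bm_path f u w * \1_A w)).
  by apply: eq_Rintegral => w _ /=; rewrite RintegralZr.
rewrite -swap; apply: eq_Rintegral => u _.
by rewrite [RHS]Rintegral_mkcond patch_indic.
Qed.

(** The compensator of f is - l (l + 1) times the time integral of f along the path;
integrating the martingale over A gives the equation solved by
[exponential_of_integral_equation]. *)
Lemma harmonic_decay l f s t A : laplace_eigenpoly l f -> 0 <= s <= t ->
  process_events B `[0, s] A ->
  \int[P]_(w in A) f (B t w) =
  expR (- ((l * l.+1)%:R * (t - s))) * \int[P]_(w in A) f (B s w).
Proof.
move=> [pf lf] /andP[s0 st] FA.
have mA : measurable A.
  apply: (process_events_measurable _ FA) => u /=; by rewrite in_itv /= => /andP[].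
have t0 := le_trans s0 st.
pose phi u := \int[P]_(w in A) bm_path f u w.
have phiE u : 0 <= u -> \int[P]_(w in A) f (B u w) = phi u.
  by move=> u0; apply: eq_Rintegral => w _; rewrite path_ge0.
rewrite !phiE //; apply: exponential_of_integral_equation; first by rewrite s0.
  exact: continuous_mean_path.
have [_ _ mean] := BM_generator BM (sphere_poly_smooth pf).
pose M u w := bm_path f u w - bm_path f 0 w
  + (l * l.+1)%:R * \int[leb]_(v in `[0, u]) bm_path f v w.
have ME u w : 0 <= u -> f (B u w) - f (B 0 w)
    - \int[leb]_(v in `[0, u]) laplace_beltrami f (B v w) = M u w.
  move=> u0; rewrite /M !path_ge0 //; congr (_ + _); rewrite -[RHS]opprK; congr (- _).
  rewrite -mulNr -RintegralZl //; last first.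
    apply: continuous_compact_integrable; first exact: segment_compact.
    by apply: continuous_subspaceT => v; exact: continuous_path.
  apply: eq_Rintegral => v /set_mem; rewrite /= in_itv /= => /andP[v0 _].
  by rewrite lf path_ge0.
have ipath u := integrable_path u pf mA.
have iM u : P.-integrable A (EFin \o M u).
  have [iI _] := mean_time_integral u pf mA.
  rewrite (_ : EFin \o M u = (fun w => (bm_path f u w)%:E) \- (fun w => (bm_path f 0 w)%:E)
    \+ (fun w => ((l * l.+1)%:R)%:E * (\int[leb]_(v in `[0, u]) bm_path f v w)%:E))%E; last first.
    by apply/funext => w /=; rewrite -EFinB -EFinM -EFinD.
  by apply: integrableD => //; [exact: integrableB|exact: integrableZl].
have meanM u : 0 <= u -> \int[P]_(w in A) M u w =
    phi u - phi 0 + (l * l.+1)%:R * \int[leb]_(v in `[0, u]) phi v.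
  move=> u0; have [iI Ieq] := mean_time_integral u pf mA.
  rewrite /M RintegralD //; last 2 first.
  - by apply: (integrableB mA (ipath u) (ipath 0)).
  - exact: integrable_scale.
  rewrite RintegralB //; [|exact: ipath|exact: ipath].
  by rewrite (RintegralZl _ mA iI) Ieq.
move=> u /andP[su ut]; have u0 := le_trans s0 su.
have /= := mean s u; rewrite s0 su => /(_ erefl A FA).
under eq_integral do rewrite ME //.
under [RHS]eq_integral do rewrite ME //.
move=> /(congr1 fine) EM.
have {EM} : \int[P]_(w in A) M u w = \int[P]_(w in A) M s w by exact: EM.
rewrite !meanM // => /eqP.
by rewrite -!addrA addrCA [eqbRHS]addrCA => /eqP/addrI.
Qed.

Lemma integrable_product f g s t : sphere_poly f -> sphere_poly g -> 0 <= s -> 0 <= t ->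
  P.-integrable setT (EFin \o (fun w => g (B s w) * f (B t w))).
Proof.
move=> pf pg s0 t0; have [M M0 fM] := sphere_poly_bounded pf.
have [G G0 gG] := sphere_poly_bounded pg.
apply: (@bounded_integrable _ _ _ _ _ _ (G * M)) => //.
- by rewrite [X in (X < _)%E](probability_setT P) ltry.
- apply: measurable_funM.
    exact: (measurableT_comp (sphere_poly_measurable pg) (BM_measurable BM s0)).
  exact: (measurableT_comp (sphere_poly_measurable pf) (BM_measurable BM t0)).
- by move=> w; rewrite normrM ler_pM.
Qed.

(** The difference f(B_t) - exp(- mu_l (t - s)) f(B_s) integrates to zero over every
event of B_s, hence is orthogonal to g(B_s). *)
Lemma harmonic_product l f g s t : laplace_eigenpoly l f -> sphere_poly g -> 0 <= s <= t ->
  \int[P]_w (g (B s w) * f (B t w)) =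
  expR (- ((l * l.+1)%:R * (t - s))) * \int[P]_w (g (B s w) * f (B s w)).
Proof.
move=> hf pg st; have [pf _] := hf; have /andP[s0 /(le_trans s0) t0] := st.
have [M M0 fM] := sphere_poly_bounded pf; have [G G0 gG] := sphere_poly_bounded pg.
set e := expR _.
have mB u : 0 <= u -> measurable_fun setT (B u) by move=> u0; exact: (BM_measurable BM u0).
have mfB u : 0 <= u -> measurable_fun setT (fun w => f (B u w)).
  by move=> u0; apply: (measurableT_comp (sphere_poly_measurable pf)); exact: mB.
have mgB : measurable_fun setT (fun w => g (B s w)).
  by apply: (measurableT_comp (sphere_poly_measurable pg)); exact: mB.
have PT (A : set Omega) : measurable A -> (P A < +oo)%E.
  by move=> mA; rewrite (le_lt_trans (probability_le1 _ mA)) // ltry.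
have ifB u A : 0 <= u -> measurable A -> P.-integrable A (fun w => (f (B u w))%:E).
  move=> u0 mA; apply: (@bounded_integrable _ _ _ _ _ _ M) => //; first exact: PT.
  exact/measurable_funTS/mfB.
have igf u (u0 : 0 <= u) := integrable_product pf pg s0 u0.
have := @orthogonal_of_preimages R _ _ _ _ P (B s) (fun w => f (B t w) - e * f (B s w))
  (M + e * M) (mB _ s0).
move=> /(_ _ _ _ g G (sphere_poly_measurable pg) gG) orth.
have {orth} : \int[P]_w (g (B s w) * (f (B t w) - e * f (B s w))) = 0.
  apply: orth.
  - apply: measurable_funB; first exact: mfB.
    by apply: measurable_funM => //; exact: mfB.
  - move=> w; rewrite (le_trans (ler_normB _ _)) // lerD // normrM ler_pM //.
    by rewrite ger0_norm // expR_ge0.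
  - move=> U mU.
    have FU : process_events B `[0, s] (B s @^-1` U).
      apply: sub_gen_smallest; exists s; first by rewrite /= in_itv /= s0 lexx.
      by exists U.
    have mBU : measurable (B s @^-1` U).
      by rewrite -[X in measurable X]setTI; exact: mB.
    rewrite RintegralB //; [|exact: ifB|]; last first.
      by apply: integrable_scale => //; exact: ifB.
    rewrite RintegralZl //; last exact: ifB.
    by rewrite (harmonic_decay hf st FU) subrr.
have -> : \int[P]_w (g (B s w) * (f (B t w) - e * f (B s w))) =
    \int[P]_w (g (B s w) * f (B t w) - e * (g (B s w) * f (B s w))).
  by apply: eq_Rintegral => w _; ring.
rewrite RintegralB //; [|exact: igf|]; last first.
  by apply: integrable_scale => //; exact: igf.
rewrite RintegralZl //; last exact: igf.
by move=> /eqP; rewrite subr_eq0 => /eqP.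
Qed.

(** Each product in K_l(B_s, B_t) decays at the same rate, and K_l(B_s, B_s) is
constant. *)
Lemma mean_zonal_kernel l s t : 0 <= s <= t ->
  P.-integrable setT (EFin \o (fun w => zonal_kernel l (B s w) (B t w))) /\
  \int[P]_w zonal_kernel l (B s w) (B t w) =
  (l.*2.+1)%:R / (4%:R * pi) * expR (- ((l * l.+1)%:R * (t - s))).
Proof.
move=> st; have /andP[s0 /(le_trans s0) t0] := st.
have mean u : 0 <= u ->
    let F k w := re_harm l (k%:Z - l%:Z) (B s w) * re_harm l (k%:Z - l%:Z) (B u w)
      + im_harm l (k%:Z - l%:Z) (B s w) * im_harm l (k%:Z - l%:Z) (B u w) in
    P.-integrable setT (EFin \o (fun w => zonal_kernel l (B s w) (B u w))) /\
    \int[P]_w zonal_kernel l (B s w) (B u w) = \sum_(k < l.*2.+1) \int[P]_w F k w.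
  move=> u0 F; apply: Rintegral_sum => k.
  have [pr _] := re_harm_eigenpoly (R := R) l (k%:Z - l%:Z).
  have [pi _] := im_harm_eigenpoly (R := R) l (k%:Z - l%:Z).
  by apply: integrable_add => //; exact: integrable_product.
split; first by have [] := mean t t0.
rewrite (mean t t0).2 mulrC.
have -> : (l.*2.+1)%:R / (4 * pi) = \int[P]_w zonal_kernel l (B s w) (B s w).
  under eq_Rintegral do rewrite zonal_kernel_diag.
  by rewrite Rintegral_cst // [X in fine X](probability_setT P) mulr1.
rewrite (mean s s0).2 mulr_sumr; apply: eq_bigr => k _.
have hr := re_harm_eigenpoly (R := R) l (k%:Z - l%:Z).
have hi := im_harm_eigenpoly (R := R) l (k%:Z - l%:Z).
have [[pr _] [pi _]] := (hr, hi).
have it f u (pf : sphere_poly f) (u0 : 0 <= u) := integrable_product pf pf s0 u0.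
rewrite !RintegralD //; do ?exact: it.
by rewrite (harmonic_product hr) // (harmonic_product hi) // -mulrDr.
Qed.

End brownian_decay.

(** * Second moments of the field *)

Section cauchy_schwarz.
Context {R : realType} d {X : measurableType d}.
Variable m : {finite_measure set X -> \bar R}.

(** The Cauchy-Schwarz inequality with a bounded second factor; the right-hand side
is allowed to be infinite. *)
Lemma Rintegral_mul_sq_le (h g : X -> R) (G : R) :
  measurable_fun setT h -> measurable_fun setT g -> (forall x, `|g x| <= G) ->
  (((\int[m]_x (h x * g x)) ^+ 2)%:E <=
   (G ^+ 2 * fine (m setT) + 1)%:E * \int[m]_x (h x ^+ 2)%:E)%E.
Proof.
move=> mh mg gG; set S := (_ + 1)%R.
have mf : (m setT < +oo)%E by rewrite ltey_eq fin_num_measure.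
have S0 : 0 < S.
  by rewrite ltr_wpDl // mulr_ge0 ?sqr_ge0 // fine_ge0.
have mh2 : measurable_fun setT (EFin \o (fun x => h x ^+ 2)).
  by apply/measurable_EFinP; exact: measurable_funX.
have J0 : (0 <= \int[m]_x (h x ^+ 2)%:E)%E.
  by apply: integral_ge0 => x _; rewrite lee_fin sqr_ge0.
have [Joo|] := eqVneq (\int[m]_x (h x ^+ 2)%:E)%E +oo%E.
  by rewrite Joo gt0_muley ?lte_fin // leey.
rewrite -ltey => Joo.
have sh : sq_int m h.
  split=> //; apply/integrableP; split=> //.
  by under eq_integral do rewrite /= ger0_norm ?sqr_ge0 //.
have sg : sq_int m g.
  split=> //; apply: (@bounded_integrable _ _ _ _ _ _ (G ^+ 2)) => //.
    exact: measurable_funX.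
  by move=> x; rewrite normrX ler_pXn2r // nnegrE (le_trans _ (gG x)).
have hg := sq_intM sh sg.
have [_ h2] := sh; have [_ g2] := sg.
set I := Rintegral _ _ _.
pose J := \int[m]_x (h x ^+ 2).
have JE : (\int[m]_x (h x ^+ 2)%:E)%E = J%:E.
  by rewrite /J /Rintegral fineK // fin_num_abs gee0_abs.
have gS : \int[m]_x (g x ^+ 2) <= S.
  apply: (@le_trans _ _ (G ^+ 2 * fine (m setT))); last by rewrite lerDl.
  rewrite -Rintegral_cst //; apply: le_Rintegral => //.
    by apply: (@bounded_integrable _ _ _ _ _ _ `|G ^+ 2|).
  move=> x _; rewrite -(real_normK (num_real (g x))) ler_pXn2r // nnegrE.
  exact: le_trans (gG x).
have quad (t : R) : 0 <= J - 2 * t * I + t ^+ 2 * \int[m]_x (g x ^+ 2).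
  have : 0 <= \int[m]_x ((h x - t * g x) ^+ 2).
    by apply: Rintegral_ge0 => x _; exact: sqr_ge0.
  rewrite (_ : Rintegral _ _ _ = \int[m]_x (h x ^+ 2 - 2 * t * (h x * g x) + t ^+ 2 * (g x ^+ 2))).
    rewrite RintegralD ?RintegralB ?RintegralZl //;
      do ?[exact: integrable_scale | apply: integrable_sub => //].
  by apply: eq_Rintegral => x _; ring.
rewrite JE -EFinM lee_fin.
(* The minimiser, if S were the integral of g^2 itself. *)
have := quad (I / S).
have : (I / S) ^+ 2 * \int[m]_x (g x ^+ 2) <= (I / S) ^+ 2 * S.
  by rewrite ler_wpM2l // sqr_ge0.
have -> : (I / S) ^+ 2 * S = I ^+ 2 / S by field; rewrite gt_eqF.
have -> : 2 * (I / S) * I = I ^+ 2 / S + I ^+ 2 / S by field; rewrite gt_eqF.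
move=> h1 h3; have : I ^+ 2 / S <= J by lra.
by rewrite ler_pdivrMr // mulrC.
Qed.
End cauchy_schwarz.

Section field_moments.
Context {R : realType} d {Omega : measurableType d}.
Variables (P : probability Omega R) (T : sphere R -> Omega -> R).
Hypothesis iso : isotropic_field P T.
Local Notation lam := (@surface_measure R).

Lemma measurable_field x : measurable_fun setT (T x).
Proof. exact: (measurableT_comp (field_measurable iso) (pair1_measurable x)). Qed.

Lemma measurable_field_section w : measurable_fun setT (T^~ w).
Proof. exact: (measurableT_comp (field_measurable iso) (pair2_measurable w)). Qed.

(** The second moment is invariant under rotations, which act transitively. *)
Lemma second_moment_cst : exists c, forall x, (\int[P]_w (T x w ^+ 2)%:E)%E = c%:E.
Proof.
pose m2 x : \bar R := (\int[P]_w (T x w ^+ 2)%:E)%E.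
have inv g x : m2 (rotate g x) = m2 x.
  have := field_weakly_isotropic iso g x x; rewrite unlock => h; rewrite /m2.
  by under eq_integral do rewrite expr2; rewrite -h; under eq_integral do rewrite -expr2.
have m20 x : (0 <= m2 x)%E by apply: integral_ge0 => w _; rewrite lee_fin sqr_ge0.
exists (fine (m2 point)) => x; rewrite -/(m2 x) (rotation_invariant_cst inv x point).
rewrite fineK // ge0_fin_numE //.
by have := field_second_moment iso point; rewrite unlock.
Qed.

Lemma field_sq_int x : sq_int P (T x).
Proof.
split; first exact: measurable_field.
apply/integrableP; split.
  by apply/measurable_EFinP; apply: measurable_funX; exact: measurable_field.
under eq_integral do rewrite /= ger0_norm ?sqr_ge0 //.
by have [c ->] := second_moment_cst; rewrite ltry.
Qed.

Let K w : \bar R := (\int[lam]_x (T x w ^+ 2)%:E)%E.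

Let measurable_sq : measurable_fun setT (fun p : sphere R * Omega => (T p.1 p.2 ^+ 2)%:E).
Proof. by apply/measurable_EFinP; apply: measurable_funX; exact: (field_measurable iso). Qed.

Let K_meas : measurable_fun setT K.
Proof.
apply: (measurable_fun_fubini_tonelli_G (m1 := lam) (fun p => (T p.1 p.2 ^+ 2)%:E)) => //.
by move=> p; rewrite lee_fin sqr_ge0.
Qed.

Let K_fin : (\int[P]_w K w < +oo)%E.
Proof.
rewrite /K -(fubini_tonelli (m1 := lam) (m2 := P) (fun p => (T p.1 p.2 ^+ 2)%:E)) //=; last first.
  by move=> p; rewrite lee_fin sqr_ge0.
have [c hc] := second_moment_cst.
under eq_integral do rewrite hc.
have c0 : (0 <= c%:E)%E by rewrite -(hc point); apply: integral_ge0 => w _; rewrite lee_fin sqr_ge0.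
by rewrite integral_cst // lte_mul_pinfty // -ge0_fin_numE // fin_num_measure.
Qed.

(** By Cauchy-Schwarz the square of the coefficient is dominated by the integral of
T^2 over the sphere, whose mean is finite because the second moment is constant
and the sphere has finite area. *)
Lemma coef_sq_int (h : sphere R -> R) (M : R) : measurable_fun setT h ->
  (forall x, `|h x| <= M) -> sq_int P (fun w => \int[lam]_x (T x w * h x)).
Proof.
move=> mh hM.
have mTh : measurable_fun setT (fun p : sphere R * Omega => (T p.1 p.2 * h p.1)%:E).
  apply/measurable_EFinP; apply: measurable_funM; first exact: (field_measurable iso).
  exact: measurableT_comp.
have ma : measurable_fun setT (fun w => \int[lam]_x (T x w * h x)).
  rewrite /Rintegral; apply: measurableT_comp => //.
  under eq_fun do rewrite integralE.
  apply: emeasurable_funB.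
    have H := measurable_fun_fubini_tonelli_G (m1 := lam) _ (measurable_funepos mTh)
      (fun p => funepos_ge0 _ p).
    apply: (eq_measurable_fun _ _ H) => w _; rewrite /fubini_G.
    by apply: eq_integral => x _; rewrite !funeposE.
  have H := measurable_fun_fubini_tonelli_G (m1 := lam) _ (measurable_funeneg mTh)
    (fun p => funeneg_ge0 _ p).
  apply: (eq_measurable_fun _ _ H) => w _; rewrite /fubini_G.
  by apply: eq_integral => x _; rewrite !funenegE.
split => //; apply/integrableP; split.
  by apply/measurable_EFinP; exact: measurable_funX.
under eq_integral do rewrite /= ger0_norm ?sqr_ge0 //.
set S := M ^+ 2 * fine (lam setT) + 1.
have S0 : 0 <= S by rewrite addr_ge0 // mulr_ge0 ?sqr_ge0 // fine_ge0.
have K0 w : (0 <= K w)%E by apply: integral_ge0 => x _; rewrite lee_fin sqr_ge0.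
apply: (@le_lt_trans _ _ (\int[P]_w (S%:E * K w))%E).
  apply: ge0_le_integral => //.
  - by move=> w _; rewrite lee_fin sqr_ge0.
  - by apply/measurable_EFinP; exact: measurable_funX.
  - exact: measurable_funeM.
  - by move=> w _; apply: Rintegral_mul_sq_le => //; exact: measurable_field_section.
by rewrite ge0_integralZl // lte_mul_pinfty.
Qed.

Lemma fourier_coef_sq_int l n : complex_sq_int P (fourier_coef T l n).
Proof.
have [[pr _] [pi _]] := (re_harm_eigenpoly (R := R) l n, im_harm_eigenpoly (R := R) l n).
have [Mr _ hr] := sphere_poly_bounded pr; have [Mi _ hi] := sphere_poly_bounded pi.
split.
  rewrite (_ : (fun w => _) = fun w => \int[lam]_x (T x w * re_harm l n x)).
    by apply: coef_sq_int hr; exact: sphere_poly_measurable.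
  apply/funext => w /=; apply: eq_Rintegral => x _.
  by rewrite Re_mul_realC Re_conj.
rewrite (_ : (fun w => _) = fun w => \int[lam]_x (T x w * - im_harm l n x)).
  apply: (@coef_sq_int _ Mi); last by move=> x; rewrite normrN.
  by apply: measurableT_comp => //; exact: sphere_poly_measurable.
apply/funext => w /=; apply: eq_Rintegral => x _.
by rewrite Im_mul_realC Im_conj.
Qed.

End field_moments.

(** * The covariance as a limit of harmonic sums *)

Section covariance.
Context {R : realType} d {Omega : measurableType d}.
Variables (P : probability Omega R) (T : sphere R -> Omega -> R) (C : nat -> R).
Hypothesis iso : isotropic_field P T.
Hypothesis spectral : spectral_representation P T.
Hypothesis spectrum : angular_power_spectrum P T C.
Local Notation S := (spectral_partial_sum T).
Local Notation a := (fourier_coef T).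
Local Notation CI := (Rintegral_complex P).

Lemma order_le l (k : 'I_l.*2.+1) : `|k%:Z - l%:Z| <= l%:Z.
Proof. by have := ltn_ord k; lia. Qed.

Lemma harmonic_term_sq_int l n x : complex_sq_int P (fun w => a l n w * sph_harm l n x).
Proof. by apply: complex_sq_intZ; exact: fourier_coef_sq_int. Qed.

Lemma partial_sum_sq_int L x : complex_sq_int P (S L x).
Proof.
apply: complex_sq_int_sum => l; apply: complex_sq_int_sum => k.
exact: harmonic_term_sq_int.
Qed.

Lemma mean_harmonic_product l1 l2 m1 m2 x y : `|m1| <= l1%:Z -> `|m2| <= l2%:Z ->
  CI (fun w => a l1 m1 w * sph_harm l1 m1 x * (a l2 m2 w * sph_harm l2 m2 y)^* ) =
  if (l1 == l2) && (m1 == m2) then (C l1)%:C * (sph_harm l1 m1 x * (sph_harm l1 m1 y)^* )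
  else 0.
Proof.
move=> h1 h2; have := spectrum h1 h2 => sp.
transitivity (CI (fun w => a l1 m1 w * (a l2 m2 w)^* *
    (sph_harm l1 m1 x * (sph_harm l2 m2 y)^* ))).
  by congr Rintegral_complex; apply/funext => w; rewrite rmorphM mulrACA.
rewrite Rintegral_complexZr; last first.
  apply: complex_int_mul; first exact: fourier_coef_sq_int.
  by apply: complex_sq_int_conj; exact: fourier_coef_sq_int.
rewrite sp; case: ifPn => [/andP[/eqP <- /eqP <-]|_] //.
by rewrite mul0r.
Qed.

Lemma mean_partial_sum_product L x y : CI (fun w => S L x w * (S L y w)^* ) =
  \sum_(l < L) (C l)%:C * sum_orders l (fun m => sph_harm l m x * (sph_harm l m y)^* ).
Proof.
rewrite /spectral_partial_sum Rintegral_complex_bilinear; first last.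
- by move=> l; apply: complex_sq_int_sum => k; exact: harmonic_term_sq_int.
- by move=> l; apply: complex_sq_int_sum => k; exact: harmonic_term_sq_int.
apply: eq_bigr => l _.
have cov l' : CI (fun w => sum_orders l (fun m => a l m w * sph_harm l m x) *
      (sum_orders l' (fun m => a l' m w * sph_harm l' m y))^* ) =
    \sum_(k < l.*2.+1) \sum_(k' < l'.*2.+1)
      if (l == l' :> nat) && (k%:Z - l%:Z == k'%:Z - l'%:Z) then
      (C l)%:C * (sph_harm l (k%:Z - l%:Z) x * (sph_harm l (k%:Z - l%:Z) y)^* ) else 0.
  rewrite /sum_orders Rintegral_complex_bilinear; try by move=> k; exact: harmonic_term_sq_int.
  by apply: eq_bigr => k _; apply: eq_bigr => k' _; rewrite mean_harmonic_product // order_le.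
rewrite (bigD1 l) //= [X in _ + X]big1 ?addr0; last first.
  move=> l' l'l; rewrite cov big1 // => k _; rewrite big1 // => k' _.
  by rewrite ifN // negb_and val_eqE eq_sym l'l.
rewrite cov eqxx mulr_sumr; apply: eq_bigr => k _.
rewrite (bigD1 k) //= eqxx big1 ?addr0 // => k' k'k.
rewrite (inj_eq (addIr _)) ifN //; apply: contra k'k => /eqP[kk'].
by apply/eqP/val_inj.
Qed.

Lemma Re_mean_partial_sum_product L x y :
  \int[P]_w (complex.Re (S L x w) * complex.Re (S L y w) +
             complex.Im (S L x w) * complex.Im (S L y w))
  = \sum_(l < L) C l * zonal_kernel l x y.
Proof.
transitivity (complex.Re (CI (fun w => S L x w * (S L y w)^* ))).
  apply: eq_Rintegral => w _; rewrite Re_mul Re_conj Im_conj; ring.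
rewrite mean_partial_sum_product raddf_sum; apply: eq_bigr => l _.
rewrite /= Re_mul_realC /zonal_kernel /sum_orders raddf_sum; congr (_ * _); apply: eq_bigr => k _.
by rewrite /= Re_mul Re_conj Im_conj /re_harm /im_harm; ring.
Qed.

Lemma spectrum_ge0 l : 0 <= C l.
Proof.
have := spectrum (l1 := l) (l2 := l) (m1 := 0) (m2 := 0) isT isT.
rewrite !eqxx (_ : true && true = true) // => sp; rewrite -[C l]/(complex.Re (C l)%:C) -sp.
apply: Rintegral_ge0 => w _.
by rewrite Re_mul Re_conj Im_conj mulrN opprK -!expr2 addr_ge0 ?sqr_ge0.
Qed.

Lemma spectral_error_sq L x w : spectral_error T L x w ^+ 2 =
  (T x w - complex.Re (S L x w)) ^+ 2 + complex.Im (S L x w) ^+ 2.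
Proof.
rewrite /spectral_error; case: (S L x w) => u v /=.
by rewrite sqr_sqrtr ?addr_ge0 ?sqr_ge0 // sub0r sqrrN.
Qed.

Lemma spectral_error_cvg x :
  (fun L => \int[P]_w (spectral_error T L x w ^+ 2)) @ \oo --> 0 /\
  forall L, P.-integrable setT (EFin \o (fun w => spectral_error T L x w ^+ 2)).
Proof.
have int L : P.-integrable setT (EFin \o (fun w => spectral_error T L x w ^+ 2)).
  under eq_fun do rewrite spectral_error_sq.
  have [sr si] := partial_sum_sq_int L x.
  have sT := field_sq_int iso x.
  apply: integrable_add => //; last exact: si.2.
  have := sq_intD sT (sq_intZ (-1) sr) => -[_].
  by under eq_fun do rewrite mulN1r.
split=> //; have [/(_ x) + _] := spectral.
rewrite unlock => /fine_cvg; apply.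
Qed.

(** A weighted form of |ab| <= a^2 + b^2; its two signs of b give both sides
of [product_difference_le]. *)
Lemma weighted_young_ge0 (r a b : R) : 0 < r -> 0 <= r * a ^+ 2 + a * b + r^-1 * b ^+ 2.
Proof.
move=> r0; rewrite (_ : _ + _ = r * (a + b / (2 * r)) ^+ 2 + 3 / 4 * (r^-1 * b ^+ 2)).
  have r1 : 0 <= r^-1 by rewrite invr_ge0 ltW.
  apply: addr_ge0; apply: mulr_ge0; [exact: ltW|exact: sqr_ge0|lra|].
  by rewrite mulr_ge0 // sqr_ge0.
by field; rewrite gt_eqF.
Qed.

(** With p + i * I and q + j * I approximations of the reals u and v (I the imaginary
unit), the error on the product u v is controlled by the squared errors, with a
free weight r on the squares of u and v. *)
Lemma product_difference_le (r u v p q i j : R) : 0 < r ->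
  `|u * v - (p * q + i * j)| <= r * (u ^+ 2 + v ^+ 2)
    + (r^-1 + 1) * ((u - p) ^+ 2 + i ^+ 2 + ((v - q) ^+ 2 + j ^+ 2)).
Proof.
move=> r0; set e := u - p; set f := v - q.
have -> : p = u - e by rewrite /e; ring.
have -> : q = v - f by rewrite /f; ring.
have r1 : 0 <= r^-1 by rewrite invr_ge0 ltW.
have ij : 0 <= r^-1 * (i ^+ 2 + j ^+ 2) by rewrite mulr_ge0 // addr_ge0 ?sqr_ge0.
have Y1 b := weighted_young_ge0 u b r0; have Y2 b := weighted_young_ge0 v b r0.
have E1 b := weighted_young_ge0 e b ltr01; have E2 b := weighted_young_ge0 i b ltr01.
move: (Y1 f) (Y1 (- f)) (Y2 e) (Y2 (- e)) (E1 f) (E1 (- f)) (E2 j) (E2 (- j)) ij.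
rewrite invr1 !mul1r !sqrrN.
by rewrite ler_norml => *; apply/andP; split; lra.
Qed.

(** The product T(x) T(y) is approximated in mean by the real part of
S_L(x) conj(S_L(y)), S_L being the partial sums: the error is at most r times a
constant, plus a multiple of the L^2 errors, which tend to zero for each r. *)
Lemma covariance_cvg x y :
  (fun L => \sum_(l < L) C l * zonal_kernel l x y) @ \oo --> \int[P]_w (T x w * T y w).
Proof.
have [ex ix] := spectral_error_cvg x; have [ey iy] := spectral_error_cvg y.
have sx := field_sq_int iso x; have sy := field_sq_int iso y.
pose c := \int[P]_w (T x w ^+ 2) + \int[P]_w (T y w ^+ 2).
pose e L := \int[P]_w (spectral_error T L x w ^+ 2) + \int[P]_w (spectral_error T L y w ^+ 2).
have c0 : 0 <= c by rewrite addr_ge0 // Rintegral_ge0 // => w _; rewrite sqr_ge0.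
have ce : e @ \oo --> 0 by rewrite -[X in _ --> X](addr0 0); apply: cvgD; [exact: ex|exact: ey].
have bound L (r : R) : 0 < r ->
    `|\int[P]_w (T x w * T y w) - \sum_(l < L) C l * zonal_kernel l x y|
    <= r * c + (r^-1 + 1) * e L.
  move=> r0.
  have [sxr sxi] := partial_sum_sq_int L x; have [syr syi] := partial_sum_sq_int L y.
  have iTT := sq_intM sx sy.
  have iSS := integrable_add measurableT (sq_intM sxr syr) (sq_intM sxi syi).
  rewrite -Re_mean_partial_sum_product -RintegralB //.
  apply: (le_trans (le_normr_Rintegral _ _)) => //; first exact: integrable_sub.
  have -> : r * c + (r^-1 + 1) * e L = \int[P]_w (r * (T x w ^+ 2 + T y w ^+ 2) +
      (r^-1 + 1) * (spectral_error T L x w ^+ 2 + spectral_error T L y w ^+ 2)).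
    have i1 := integrable_add measurableT sx.2 sy.2.
    have i2 := integrable_add measurableT (ix L) (iy L).
    have i1' := integrable_scale r measurableT i1.
    have i2' := integrable_scale (r^-1 + 1) measurableT i2.
    rewrite RintegralD // !RintegralZl // !RintegralD //.
      exact: sx.2.
    exact: sy.2.
  apply: le_Rintegral => //.
  - have := integrable_norm (integrable_sub measurableT iTT iSS); exact.
  - apply: integrable_add => //; apply: integrable_scale => //; apply: integrable_add => //.
      exact: sx.2.
    exact: sy.2.
  move=> w _; rewrite !spectral_error_sq.
  set u := T x w; set v := T y w; set p := complex.Re _; set q := complex.Re _.
  set i := complex.Im _; set j := complex.Im _.
  exact: product_difference_le.
apply/cvgrPdist_le => eps eps0.
(* c + 1 rather than c, which may be 0. *)
pose r := eps / (2 * (c + 1)).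
have c1 : 0 < c + 1 by rewrite ltr_wpDl.
have r0 : 0 < r by rewrite divr_gt0 // mulr_gt0.
have k0 : 0 < r^-1 + 1 by rewrite addr_gt0 // invr_gt0.
have rc : r * c <= eps / 2.
  have -> : r * c = eps / 2 * (c / (c + 1)) by rewrite /r; field; rewrite gt_eqF.
  by rewrite ler_piMr ?divr_ge0 ?ltW // ltr_pdivrMr // mul1r ltrDl.
have d0 : 0 < eps / 2 / (r^-1 + 1) by rewrite !divr_gt0.
near=> L.
rewrite (le_trans (bound L r r0)) // [leRHS]splitr lerD //.
rewrite mulrC -ler_pdivlMr //.
have : `|0 - e L| <= eps / 2 / (r^-1 + 1).
  by near: L; move/cvgrPdist_le : ce; apply.
by rewrite sub0r normrN; apply: le_trans; exact: ler_norm.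
Unshelve. all: by end_near. Qed.

End covariance.

(** * Freezing an independent variable *)

Section freezing.
Context {R : realType} d d1 d2 {X : measurableType d} {Y1 : measurableType d1}
  {Y2 : measurableType d2}.
Variable P : probability X R.

(** If U and V are independent, the law of (U, V) is the product of their laws, and
Fubini's theorem averages U for fixed V. *)
Lemma freezing (U : {mfun X >-> Y1}) (V : {mfun X >-> Y2}) (h : Y1 * Y2 -> R) (M : R) :
  (forall A1 A2, measurable A1 -> measurable A2 ->
    P (U @^-1` A1 `&` V @^-1` A2) = (P (U @^-1` A1) * P (V @^-1` A2))%E) ->
  measurable_fun setT h ->
  (forall y, (\int[P]_w `|h (U w, y)|%:E <= M%:E)%E) ->
  (\int[P]_w (h (U w, V w))%:E = \int[P]_w \int[P]_v (h (U v, V w))%:E)%E.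
Proof.
move=> indep mh hM.
have mUV : measurable_fun setT (fun w => (U w, V w)).
  by apply/measurable_fun_pairP; split; exact: measurable_funPT.
pose UV : {mfun X >-> (Y1 * Y2)%type} := HB.pack (fun w => (U w, V w))
  (isMeasurableFun.Build _ _ _ _ _ mUV).
pose mu := distribution P U; pose nu := distribution P V.
have mhy y : measurable_fun setT (fun u => h (u, y)).
  by apply: measurableT_comp => //.
have law (A : set (Y1 * Y2)) : measurable A -> (mu \x nu)%E A = distribution P UV A.
  apply: (@product_measure_unique _ _ _ _ R mu nu (distribution P UV)) => A1 A2 mA1 mA2.
  by rewrite -indep.
have mhE : measurable_fun setT (EFin \o h) by exact/measurable_EFinP.
have mabs : measurable_fun setT (abse \o (EFin \o h)) by exact: measurableT_comp.
have hint : (mu \x nu)%E.-integrable setT (EFin \o h).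
  apply/integrable21ltyP => //.
  apply: (@le_lt_trans _ _ (\int[nu]_y (cst M%:E y))%E).
    apply: ge0_le_integral => //.
    - by move=> y _; apply: integral_ge0.
    - exact: (measurable_fun_fubini_tonelli_G (m1 := mu) _ mabs (fun p => abse_ge0 _)).
    - move=> y _; rewrite ge0_integral_pushforward //=.
      by apply/measurable_EFinP; exact: measurableT_comp.
  have nu1 : nu setT = 1%E by exact: probability_setT.
  by rewrite integral_cst // [X in (_ * X)%E]nu1 mule1 ltry.
have hUV : P.-integrable setT (EFin \o h \o UV).
  apply/integrableP; split; first exact: measurableT_comp.
  have /integrableP[_] := hint.
  rewrite (eq_measure_integral (distribution P UV)) => [|A mA _]; last exact: law.
  by rewrite ge0_integral_pushforward.
transitivity (\int[distribution P UV]_y (EFin \o h) y)%E.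
  by rewrite integral_pushforward.
rewrite -(eq_measure_integral (distribution P UV) (m1 := (mu \x nu)%E)); last first.
  by move=> A mA _; exact: law.
pose G y := (\int[P]_v (h (U v, y))%:E)%E.
have hUy y : P.-integrable setT (EFin \o (fun v => h (U v, y))).
  apply/integrableP; split; first by apply/measurable_EFinP; apply: (measurableT_comp (mhy y)).
  exact: le_lt_trans (hM y) (ltry _).
have GE y : (\int[mu]_x (EFin \o h) (x, y))%E = G y.
  have mE : measurable_fun setT (fun x => (EFin \o h) (x, y)) by apply/measurable_EFinP; exact: mhy.
  by rewrite (integral_pushforward _ mE (hUy y)).
have mG : measurable_fun setT G.
  by rewrite -(funext GE); exact: (measurable_fubini_G hint).
have GV : P.-integrable setT (G \o V).
  apply/integrableP; split; first exact: measurableT_comp.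
  apply: (@le_lt_trans _ _ (\int[P]_w (cst M%:E w))%E).
    apply: ge0_le_integral => //.
      by apply: measurableT_comp => //; exact: measurableT_comp.
    move=> w _; apply: le_trans (hM (V w)).
    by apply: le_abse_integral => //; have /integrableP[] := hUy (V w).
  by rewrite integral_cst // [X in (_ * X)%E](probability_setT P) mule1 ltry.
rewrite -integral21_prod_meas1 //; transitivity (\int[nu]_y G y)%E.
  by apply: eq_integral => y _; exact: GE.
by rewrite integral_pushforward.
Qed.

End freezing.

(** * The field along the Brownian path *)

Section composition.
Context {R : realType} d {Omega : measurableType d}.
Variables (P : probability Omega R) (T : sphere R -> Omega -> R) (C : nat -> R).
Hypothesis iso : isotropic_field P T.
Variables (x0 : sphere R) (B : R -> Omega -> sphere R).
Hypothesis BM : rotational_BM P x0 B.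
Hypothesis indep : independent_field_process P T B.

Definition covariance_fun (y1 y2 : sphere R) : R := \int[P]_w (T y1 w * T y2 w).

(** Freezing, with U the identity from the original sigma-algebra to the one that
carries T, and V = (B_s, B_t). *)
Lemma mean_composition s t : 0 <= s -> 0 <= t ->
  (\int[P]_w (T (B s w) w * T (B t w) w)%:E =
   \int[P]_w (covariance_fun (B s w) (B t w))%:E)%E.
Proof.
move=> s0 t0; have [G [Gsub mT ind]] := indep.
pose OG := g_sigma_algebraType G.
have mU : measurable_fun setT (id : Omega -> OG).
  by move=> _ A mA; rewrite setTI; exact: Gsub.
pose U : {mfun Omega >-> OG} := HB.pack (id : Omega -> OG)
  (isMeasurableFun.Build _ _ _ _ _ mU).
have mV : measurable_fun setT (fun w => (B s w, B t w)).
  by apply/measurable_fun_pairP; split; [exact: (BM_measurable BM s0)|exact: (BM_measurable BM t0)].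
pose V : {mfun Omega >-> (sphere R * sphere R)%type} := HB.pack (fun w => (B s w, B t w))
  (isMeasurableFun.Build _ _ _ _ _ mV).
pose h (p : OG * (sphere R * sphere R)) : R := T p.2.1 p.1 * T p.2.2 p.1.
have [c hc] := second_moment_cst iso.
have mh : measurable_fun setT h.
  have m1 : measurable_fun setT (fun p : OG * (sphere R * sphere R) => (p.2.1, p.1)).
    apply/measurable_fun_pairP; split; last exact: measurable_fst.
    exact: (measurableT_comp measurable_fst measurable_snd).
  have m2 : measurable_fun setT (fun p : OG * (sphere R * sphere R) => (p.2.2, p.1)).
    apply/measurable_fun_pairP; split; last exact: measurable_fst.
    exact: (measurableT_comp measurable_snd measurable_snd).
  by apply: measurable_funM; [exact: (measurableT_comp mT m1)|exact: (measurableT_comp mT m2)].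
rewrite (@freezing R _ _ _ _ _ _ P U V h (c + c)) //; last first.
- move=> [y1 y2] /=; rewrite EFinD -{1}(hc y1) -(hc y2).
  have [[m1 i1] [m2 i2]] := (field_sq_int iso y1, field_sq_int iso y2).
  rewrite -ge0_integralD //; last 4 first.
  - by move=> w _; rewrite lee_fin sqr_ge0.
  - by have /integrableP[] := i1.
  - by move=> w _; rewrite lee_fin sqr_ge0.
  - by have /integrableP[] := i2.
  apply: ge0_le_integral => //.
  - by apply/measurable_EFinP; apply: measurableT_comp => //; exact: measurable_funM.
  - by apply: emeasurable_funD; [have /integrableP[] := i1|have /integrableP[] := i2].
  - move=> w _; rewrite /= -EFinD lee_fin; exact: abs_mul_le.
- move=> A1 A2 mA1 mA2; apply: ind => //.
  pose OB := g_sigma_algebraType [set A : set Omega |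
    exists2 t, `[0, +oo[%classic t & exists2 V, measurable V & A = B t @^-1` V].
  have mB (u : R) : 0 <= u -> measurable_fun setT (B u : OB -> sphere R).
    move=> u0 _ A mA; rewrite setTI; apply: sub_gen_smallest.
    by exists u; [rewrite /= in_itv /= andbT|exists A].
  have mBB : measurable_fun setT (fun w : OB => (B s w, B t w)).
    by apply/measurable_fun_pairP; split; [exact: (mB s)|exact: (mB t)].
  by have := mBB measurableT A2 mA2; rewrite setTI.
apply: eq_integral => w _; rewrite /covariance_fun /Rintegral fineK //.
exact/integrable_fin_num/(sq_intM (field_sq_int iso _) (field_sq_int iso _)).
Qed.
End composition.

(** * The covariance of the composition *)

Section assembly.
Context {R : realType} d {Omega : measurableType d}.
Variables (P : probability Omega R) (T : sphere R -> Omega -> R) (C : nat -> R).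
Hypothesis iso : isotropic_field P T.
Hypothesis spectral : spectral_representation P T.
Hypothesis spectrum : angular_power_spectrum P T C.
Hypothesis C_summable : (\sum_(0 <= l <oo) ((l.*2.+1)%:R * C l)%:E < +oo)%E.
Variables (x0 : sphere R) (B : R -> Omega -> sphere R).
Hypothesis BM : rotational_BM P x0 B.

(** A bound on the partial sums that is uniform in the number of terms and in the
points, for dominated convergence. *)
Lemma zonal_kernel_sum_bounded : exists D, forall L y1 y2,
  `|\sum_(l < L) C l * zonal_kernel l y1 y2| <= D.
Proof.
have C0 := spectrum_ge0 spectrum.
have F0 l : (0 <= ((l.*2.+1)%:R * C l)%:E)%E by rewrite lee_fin mulr_ge0.
pose K := fine (\sum_(0 <= l <oo) ((l.*2.+1)%:R * C l)%:E)%E.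
have pK L : \sum_(l < L) (l.*2.+1)%:R * C l <= K.
  rewrite -lee_fin /K fineK; last first.
    by rewrite ge0_fin_numE //; apply: nneseries_ge0 => l _ _; exact: F0.
  rewrite -sumEFin -(big_mkord xpredT (fun l => ((l.*2.+1)%:R * C l)%:E)).
  by apply: nneseries_lim_ge => l _ _; exact: F0.
exists (K / (4%:R * pi)) => L y1 y2.
rewrite (le_trans (ler_norm_sum _ _ _)) // (@le_trans _ _
  ((\sum_(l < L) (l.*2.+1)%:R * C l) / (4%:R * pi))) //; last first.
  by rewrite ler_wpM2r // invr_ge0 mulr_ge0 // pi_ge0.
rewrite mulr_suml; apply: ler_sum => l _.
rewrite normrM ger0_norm // mulrAC mulrC.
by apply: ler_wpM2r => //; exact: zonal_kernel_le.
Qed.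

Lemma mean_covariance_fun s t : 0 <= s <= t ->
  (\int[P]_w (covariance_fun P T (B s w) (B t w))%:E =
  \sum_(0 <= l <oo) ((l.*2.+1)%:R / (4%:R * pi) * C l
          * expR (- ((l * l.+1)%:R * (t - s))))%:E)%E.
Proof.
move=> st.
have [D KD] := zonal_kernel_sum_bounded.
have mker l := mean_zonal_kernel BM l st.
pose f L w : \bar R := (\sum_(l < L) C l * zonal_kernel l (B s w) (B t w))%:E.
have iS L := Rintegral_sum (fun l : 'I_L => integrable_scale (C l) measurableT (mker l).1).
have intf L : (\int[P]_w f L w = (\sum_(l < L) ((l.*2.+1)%:R / (4%:R * pi) * C l
          * expR (- ((l * l.+1)%:R * (t - s))))%:E))%E.
  have [iL eL] := iS L.
  rewrite /f sumEFin; transitivity (Rintegral P setT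
    (fun w => \sum_(l < L) C l * zonal_kernel l (B s w) (B t w)))%:E.
    by rewrite /Rintegral fineK //; exact: integrable_fin_num.
  rewrite eL; congr EFin; apply: eq_bigr => l _.
  by rewrite (RintegralZl _ measurableT (mker l).1) (mker l).2; ring.
have cf : (fun L => \int[P]_w f L w)%E @ \oo -->
    (\int[P]_w (covariance_fun P T (B s w) (B t w))%:E)%E.
  apply: (@dominated_cvg _ _ _ P setT measurableT f _ (cst D%:E)) => //.
  - by move=> L; have [/integrableP[]] := iS L.
  - move=> w _; apply: cvg_EFin; first exact: nearW.
    exact: (covariance_cvg iso spectral spectrum).
  - by apply: finite_measure_integrable_cst.
  - by move=> L w _; rewrite /f /= lee_fin; exact: KD.
apply/esym/cvg_lim => //; apply: cvg_trans cf; apply: near_eq_cvg; near=> L.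
by rewrite intf big_mkord.
Unshelve. all: by end_near. Qed.

End assembly.

Theorem theorem1p8 (R : realType) (d : measure_display)
    (Omega : measurableType d) (P : probability Omega R)
    (T : sphere R -> Omega -> R) (C : nat -> R)
    (B : sphere R -> R -> Omega -> sphere R) (t0 t1 t2 : R)
    (T_field : isotropic_field P T)
    (T_spectral : spectral_representation P T)
    (T_spectrum : angular_power_spectrum P T C)
    (C_summable : (\sum_(0 <= l <oo) ((l.*2.+1)%:R * C l)%:E < +oo)%E)
    (B_brownian : forall x, rotational_BM P x (B x))
    (T_B_independent : forall x, independent_field_process P T (B x))
    (t0_ge0 : 0 <= t0) (t0_lt_t1 : t0 < t1) (t1_le_t2 : t1 <= t2) :
  forall (x : sphere R) (g : SO3 R),
    ('E_P[(fun w => coordinate_changed_field T B t0 t1 (rotate g x) w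
                    * coordinate_changed_field T B t0 t2 (rotate g x) w)%R]
     = \sum_(0 <= l <oo)
         ((l.*2.+1)%:R / (4%:R * pi) * C l
          * expR (- ((l * l.+1)%:R * (t2 - t1))))%:E)%E.
Proof.
move=> x g; set y := rotate g x.
have s0 : 0 <= t1 - t0 by rewrite subr_ge0 ltW.
have st : t1 - t0 <= t2 - t0 by rewrite lerD2r.
rewrite unlock /coordinate_changed_field.
rewrite (mean_composition T_field (B_brownian y) (T_B_independent y) s0 (le_trans s0 st)).
rewrite (mean_covariance_fun T_field T_spectral T_spectrum C_summable (B_brownian y)).
  by have -> : t2 - t0 - (t1 - t0) = t2 - t1 by ring.
by rewrite s0.
Qed.
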